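(* Let $\mathbf{k}$ be a field of characteristic zero. There exist families of coefficients $$F^{\lambda_1,\ldots,\lambda_r},\ G^{\lambda_1,\ldots,\lambda_r}\in\mathbf{k}\qquad(r\ge 1,\ \lambda_1,\ldots,\lambda_r\in\mathbf{k}),$$ explicitly computable by induction on $r$, with the following property. Let $\mathcal{L}$ be any complete filtered Lie algebra over $\mathbf{k}$, let $X_0\in\mathcal{L}$, let $\mathcal{N}$ be a set and let $(B_n)_{n\in\mathcal{N}}$ be a formally summable family of $\mathcal{L}$ such that each $B_n$ has order $\ge 1$ and is an eigenvector of $\operatorname{ad}_{X_0}$, with eigenvalue $\lambda(n)\in\mathbf{k}$, i.e. $[X_0,B_n]=\lambda(n)B_n$. Then the following families are formally summable and the sums $$Z=\sum_{r\ge 1}\ \sum_{n_1,\ldots,n_r\in\mathcal{N}}\frac1r\,F^{\lambda(n_1),\ldots,\lambda(n_r)}\,[B_{n_r},[\ldots[B_{n_2},B_{n_1}]\ldots]],$$ $$Y=\sum_{r\ge 1}\ \sum_{n_1,\ldots,n_r\in\mathcal{N}}\frac1r\,G^{\lambda(n_1),\ldots,\lambda(n_r)}\,[B_{n_r},[\ldots[B_{n_2},B_{n_1}]\ldots]]$$ define elements $Z,Y\in\mathcal{L}_{\ge 1}$ which satisfy $$[X_0,Z]=0,\qquad e^{\operatorname{ad}_Y}\Big(X_0+\sum_{n\in\mathcal{N}}B_n\Big)=X_0+Z.$$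
   Context: A complete filtered Lie algebra is a Lie algebra $(\mathcal{L},[\cdot,\cdot])$ over $\mathbf{k}$ together with a sequence of subspaces $\mathcal{L}=\mathcal{L}_{\ge 0}\supset\mathcal{L}_{\ge 1}\supset\mathcal{L}_{\ge 2}\supset\cdots$ with $[\mathcal{L}_{\ge m},\mathcal{L}_{\ge n}]\subset\mathcal{L}_{\ge m+n}$ for all $m,n\in\mathbb{N}=\{0,1,2,\ldots\}$, such that $\bigcap_m\mathcal{L}_{\ge m}=\{0\}$ and $\mathcal{L}$ is a complete metric space for the distance $d(X,Y)=2^{-\operatorname{ord}(Y-X)}$, where the order function $\operatorname{ord}\colon\mathcal{L}\to\mathbb{N}\cup\{\infty\}$ is characterized by $\operatorname{ord}(X)\ge m\Leftrightarrow X\in\mathcal{L}_{\ge m}$. A family $(Y_i)_{i\in I}$ of $\mathcal{L}$ is formally summable if, for every $m\in\mathbb{N}$, the set $\{i\in I: Y_i\notin\mathcal{L}_{\ge m}\}$ is finite. Its support is then countable, and $\sum_{i\in I}Y_i$ denotes the common limit of the partial sums along any exhaustion of the support by finite sets. For $X_0,Y\in\mathcal{L}$, $\operatorname{ad}_Y(X)=[Y,X]$. For $Y\in\mathcal{L}_{\ge1}$, $e^{\operatorname{ad}_Y}(X)=\sum_{r\ge0}\frac1{r!}(\operatorname{ad}_Y)^r(X)$ (formally summable). For $r=1$ the iterated bracket $[B_{n_r},[\ldots[B_{n_2},B_{n_1}]\ldots]]$ means $B_{n_1}$. The zero vector is accepted as an eigenvector (some $B_n$ may vanish; the value $\lambda(n)$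 is then irrelevant). The phrase ''explicitly computable by induction on $r$'' refers to the following algorithm. View families indexed by words $\underline{n}=\lambda_1\cdots\lambda_r$ in the alphabet $\mathbf{k}$ (including the empty word $\varnothing$) as maps with values in $\mathbf{k}$; put $r(\underline n)=r$, $\sigma(\underline n)=\lambda_1+\cdots+\lambda_r$, and let ${}'\underline n=\lambda_2\cdots\lambda_r$. Let $A$ be an auxiliary family on words, which is alternal (i.e. $A^{\varnothing}=0$ and, for any two nonempty words $\underline a,\underline b$, the sum of the values of $A$ over all shuffles of $\underline a$ and $\underline b$, counted with multiplicity, is $0$) and resonant (i.e. $A^{\underline n}=0$ whenever $\sigma(\underline n)\ne0$); for example $A=0$. With $\sum^*$ denoting summation over decompositions into nonempty words, one sets $S^{\varnothing}=1$, $F^{\varnothing}=N^{\varnothing}=0$ and, for $r(\underline n)\ge1$: if $\sigma(\underline n)\neq0$, then $F^{\underline n}=0$, $S^{\underline n}=\frac{1}{\sigma(\underline n)}\big(S^{{}'\underline n}-\sum^*_{\underline n=\underline a\,\underline b}S^{\underline a}F^{\underline b}\big)$, $N^{\underline n}=r(\underline n)S^{\underline n}-\sum^*_{\underline n=\underline a\,\underline b}S^{\underline a}N^{\underline b}$; if $\sigma(\underline n)=0$, then $F^{\underline n}=S^{{}'\underline n}-\sum^*_{\underline n=\underline a\,\underline b}S^{\underline a}F^{\underline b}$, $N^{\underline n}=A^{\underline n}$, $S^{\underline n}=\frac1{r(\underline n)}\big(A^{\underline n}+\sum^*_{\underline n=\underline a\,\underline b}S^{\underline a}N^{\underline b}\big)$.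 Finally $G^{\underline n}=\sum_{k=1}^{r(\underline n)}\frac{(-1)^{k-1}}{k}\sum^*_{\underline n=\underline a^1\cdots\underline a^k}S^{\underline a^1}\cdots S^{\underline a^k}$. *)

(* Defs.v *)
(* Subsets are Prop-valued (classical_sets); distances take their values in the
   real numbers R of Stdlib, seen as a realType through Rstruct. *)
From HB Require Import structures.
From mathcomp Require Import all_boot all_order all_algebra.
From mathcomp Require Import boolp classical_sets functions cardinality fsbigop.
From mathcomp Require Import reals Rstruct.

Set Implicit Arguments.
Unset Strict Implicit.
Unset Printing Implicit Defensive.

Import Order.TTheory GRing.Theory Num.Theory.

Local Open Scope classical_set_scope.
Local Open Scope ring_scope.

HB.mixin Record Lmodule_isLie (k : fieldType) L of GRing.Lmodule k L := {
  lie : L -> L -> L;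
  lie_linearl : forall (a : k) (x y z : L),
    lie (a *: x + y) z = a *: lie x z + lie y z;
  lie_linearr : forall (a : k) (x y z : L),
    lie z (a *: x + y) = a *: lie z x + lie z y;
  lie_alternating : forall x : L, lie x x = 0;
  lie_jacobi : forall x y z : L,
    lie x (lie y z) + lie y (lie z x) + lie z (lie x y) = 0
}.

#[short(type="lieAlgebraType")]
HB.structure Definition LieAlgebra (k : fieldType) :=
  { L of Lmodule_isLie k L & GRing.Lmodule k L }.

HB.mixin Record LieAlgebra_isFiltered (k : fieldType) L of LieAlgebra k L := {
  fil : nat -> set L;
  fil_full : fil 0%N = [set: L];
  fil_decr : forall m, fil m.+1 `<=` fil m;
  fil_zero : forall m, fil m 0;
  fil_linear : forall m (a : k) (x y : L),
    fil m x -> fil m y -> fil m (a *: x + y);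
  fil_lie : forall m n (x y : L), fil m x -> fil n y -> fil (m + n)%N (lie x y);
  fil_separated : \bigcap_m fil m = [set 0]
}.

#[short(type="filteredLieType")]
HB.structure Definition FilteredLie (k : fieldType) :=
  { L of LieAlgebra_isFiltered k L & LieAlgebra k L }.

(* The order function has values in nat extended by infinity, encoded as None. *)
Definition ord (k : fieldType) (L : filteredLieType k) (x : L) : option nat :=
  if `[< forall m, fil m x >] then None
  else Some (xget 0%N [set m | fil m x /\ ~ fil m.+1 x]).

Definition ord_ge (o : option nat) (m : nat) : Prop :=
  if o is Some n then (m <= n)%N else True.

Lemma fil_le (k : fieldType) (L : filteredLieType k) (m n : nat) (x : L) :
  (m <= n)%N -> fil n x -> fil m x.
Proof.
move=> /subnK <-; elim: (n - m)%N => // d IH.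
by rewrite addSn => /fil_decr /IH.
Qed.

Lemma ord_geP (k : fieldType) (L : filteredLieType k) (x : L) (m : nat) :
  ord_ge (ord x) m <-> fil m x.
Proof.
rewrite /ord; case: asboolP => [h|h] /=; first by split.
have [n [fn fSn]] : exists n, fil n x /\ ~ fil n.+1 x.
  apply: contrapT => hn; apply: h; elim=> [|n IH]; first by rewrite fil_full.
  by apply: contrapT => fSn; apply: hn; exists n.
case: xgetP => [p _ [fp fSp]|/(_ n)]; last by case.
split=> [mp|fm]; first exact: fil_le mp fp.
by rewrite leqNgt; apply/negP => pm; apply: fSp; exact: fil_le pm fm.
Qed.

Definition dist (k : fieldType) (L : filteredLieType k) (x y : L) :
    Rdefinitions.R :=
  if ord (y - x) is Some n then 2^-1 ^+ n else 0.

Definition converges_to (k : fieldType) (L : filteredLieType k)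
    (u : nat -> L) (l : L) : Prop :=
  forall e : Rdefinitions.R, 0 < e ->
    exists p : nat, forall n, (p <= n)%N -> dist (u n) l < e.

Definition is_cauchy (k : fieldType) (L : filteredLieType k)
    (u : nat -> L) : Prop :=
  forall e : Rdefinitions.R, 0 < e ->
    exists p : nat, forall m n, (p <= m)%N -> (p <= n)%N -> dist (u m) (u n) < e.

HB.mixin Record FilteredLie_isComplete (k : fieldType) L
    of FilteredLie k L := {
  fil_complete : forall u : nat -> L,
    is_cauchy u -> exists l : L, converges_to u l
}.

#[short(type="completeFilteredLieType")]
HB.structure Definition CompleteFilteredLie (k : fieldType) :=
  { L of FilteredLie_isComplete k L & FilteredLie k L }.

Section Sums.
Variables (k : fieldType) (L : completeFilteredLieType k).

Definition formally_summable (I : Type) (Y : I -> L) : Prop :=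
  forall m : nat, finite_set [set i | ~ fil m (Y i)].

Definition exhaustion (I : Type) (S : set I) (E : nat -> set I) : Prop :=
  [/\ forall n, finite_set (E n),
      forall n, E n `<=` E n.+1
    & \bigcup_n E n = S].

(* [has_sum Y s]: Y is formally summable with sum s. The support of a formally
   summable family is countable, hence admits an exhaustion, and limits are
   unique: s is determined by Y. The alias {classic I} only provides the
   choice structure required by finitely supported sums. *)
Definition has_sum (I : Type) (Y : I -> L) (s : L) : Prop :=
  formally_summable Y /\
  forall E : nat -> set I, exhaustion [set i | Y i <> 0] E ->
    converges_to
      (fun n => \sum_(i \in (E n : set {classic I})) (Y i : L)) s.

Definition ad (y x : L) : L := lie y x.

(* [exp_ad y x z]: the series defining e^{ad_y}(x) is formally summable, with
   sum z. *)
Definition exp_ad (y x z : L) : Prop :=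
  has_sum (fun r : nat => (r`!%:R : k)^-1 *: iter r (ad y) x) z.

(* A nonempty word n_1 ... n_r is encoded as the pair (n_1, [:: n_2; ...; n_r]),
   to which is attached [B_{n_r}, [... [B_{n_2}, B_{n_1}] ...]]. *)
Definition iter_bracket (I : Type) (B : I -> L) (w : I * seq I) : L :=
  foldl (fun x n => lie (B n) x) (B w.1) w.2.

Definition comould_term (I : Type) (lambda : I -> k) (B : I -> L)
    (M : seq k -> k) (w : I * seq I) : L :=
  let n := w.1 :: w.2 in
  ((size n)%:R^-1 * M (map lambda n)) *: iter_bracket B w.

End Sums.

(* The list of all shuffles of two words, with multiplicity. *)
Fixpoint shuffles (T : Type) (a b : seq T) {struct a} : seq (seq T) :=
  if a is x :: a' then
    (fix sh (b : seq T) : seq (seq T) :=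
       if b is y :: b' then
         [seq x :: w | w <- shuffles a' b] ++ [seq y :: w | w <- sh b']
       else [:: a]) b
  else [:: b].

Section Moulds.
Variable k : fieldType.
Implicit Types (M : seq k -> k) (w : seq k).

Definition sigma w : k := \sum_(x <- w) x.

Definition alternal M : Prop :=
  M [::] = 0 /\
  forall a b : seq k, a <> [::] -> b <> [::] ->
    \sum_(w <- shuffles a b) M w = 0.

Definition resonant M : Prop := forall w, sigma w != 0 -> M w = 0.

(* Sum over the decompositions w = a b into two nonempty words. *)
Definition star M1 M2 w : k :=
  \sum_(1 <= i < size w) M1 (take i w) * M2 (drop i w).

(* Sum of M a^1 ... M a^j over the decompositions w = a^1 ... a^j into j
   nonempty words; a^1 is a nonempty prefix of w. *)
Fixpoint star_pow M (j : nat) w : k :=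
  if j is j'.+1 then
    \sum_(1 <= i < (size w).+1) M (take i w) * star_pow M j' (drop i w)
  else (w == [::])%:R.

(* The equations below determine S, F, N and G from A, by induction on the
   length of words. *)
Record normalizing_moulds (A S F N G : seq k -> k) : Prop := {
  mould_S0 : S [::] = 1;
  mould_F0 : F [::] = 0;
  mould_N0 : N [::] = 0;
  mould_nonresonant : forall w, w <> [::] -> sigma w != 0 ->
    [/\ F w = 0,
        S w = (sigma w)^-1 * (S (behead w) - star S F w)
      & N w = (size w)%:R * S w - star S N w];
  mould_resonant : forall w, w <> [::] -> sigma w = 0 ->
    [/\ F w = S (behead w) - star S F w,
        N w = A w
      & S w = (size w)%:R^-1 * (A w + star S N w)];
  mould_log : forall w,
    G w = \sum_(1 <= j < (size w).+1)
            (-1) ^+ j.-1 / j%:R * star_pow S j w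
}.

Lemma alternal0 : alternal (fun=> 0).
Proof. by split=> // a b _ _; rewrite big1. Qed.

Lemma resonant0 : resonant (fun=> 0).
Proof. by []. Qed.

End Moulds.

(* Main.v *)
Require Import Defs.
From HB Require Import structures.
From mathcomp Require Import all_boot all_order all_algebra.
From mathcomp Require Import boolp classical_sets functions cardinality fsbigop.
From mathcomp Require Import reals Rstruct ring zify.

Set Implicit Arguments.
Unset Strict Implicit.
Unset Printing Implicit Defensive.

Import Order.TTheory GRing.Theory Num.Theory.
Local Open Scope ring_scope.

(** Maps from words to [k] are multiplied by cutting words in two; the formal
    series [\sum_w M w B_(n_r) ... B_(n_1)] attached to a mould [M] over a
    family of noncommuting [B_n] then multiplies in the opposite order.  If
    [nabla] denotes the multiplication of [M w] by [sigma w], it corresponds to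
    the bracket with [X0], since each [B_n] is an eigenvector.  The clauses
    that define [S], [F] and [N] amount to
    [nabla S = letter * S - S * F] with [nabla F = 0] ([derivation_sigma_S],
    [resonant_F]), and [r(w) S w = (S * N) w] ([derivation_size_S]) with
    [N w = A w] when [sigma w = 0].  In a
    formal associative setting the theorem is then immediate: with
    [Y = log S],
    [e^Y (X0 + \sum_n B_n) e^(-Y) = X0 + (S^-1 * (letter * S - nabla S)) B
      = X0 + F B].

    To give this a meaning inside a Lie algebra, without an enveloping algebra,
    associative words are traded for iterated brackets weighted by [1 / r].
    This is legitimate for alternal moulds, and rests on four facts.

    - [S] is symmetral ([normalizing_symmetries], by induction on the total
      length of two shuffled words: the two equations above force
      [sh S a b = S a * S b], by inverting [sigma a + sigma b] when it is
      nonzero and the total length otherwise).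
    - [G = log S] is alternal and [S = exp G] ([primitive_log_mould],
      [exp_log_mould]).  Each value of the powers [S ^ n] is a polynomial in
      [n], of which [G] gives the linear coefficient, and all powers of [S] are
      symmetral.
    - The weighted sums of iterated brackets attached to alternal moulds form a
      Lie algebra, with the bracket of moulds reversed ([lie_comould_upto]).
      This follows from the Dynkin-Specht-Wever identity [lie_sum_nested],
      which is proved directly for the adjoint action on [L]: it only needs
      the Jacobi identity and the reversal rule [primitive_reversal] of
      alternal moulds.
    - In the algebra of moulds, [e^(-G) (letter - nabla) e^G = F - nabla], in
      the expanded form of iterated commutators ([conj_mould_exp]), which are
      the moulds of the successive terms of [e^(ad Y)].

    Convergence is handled one order [m] at a time: modulo [fil m] only
    finitely many [B_n] and the words of length at most [m] on them count, so
    that all sums become finite ([carried_has_sum], [has_sumI]). *)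

(** * The algebra of moulds *)

(** Functions into [k] already carry a pointwise product; the alias [mould]
    keeps it apart from the concatenation product. *)
Definition mould (T : Type) (k : fieldType) : Type := seq T -> k.

HB.instance Definition _ (T : Type) (k : fieldType) :=
  GRing.Lmodule.copy (mould T k) (seq T -> k^o).

Section MouldRing.
Variables (T : Type) (k : fieldType).
Implicit Types (M N P S : mould T k) (w : seq T).

Definition mould1 : mould T k := fun w => (nilp w)%:R.

Definition mould_mul M N : mould T k :=
  fun w => \sum_(0 <= i < (size w).+1) M (take i w) * N (drop i w).

(** Inductions on words expose the first letter and replace [M] by its shift. *)
Definition shift (x : T) M : mould T k := fun w => M (x :: w).

Lemma mould_mul_nil M N : mould_mul M N [::] = M [::] * N [::].
Proof. by rewrite /mould_mul big_nat1. Qed.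

Lemma mould_mul_cons M N x w :
  mould_mul M N (x :: w) = M [::] * N (x :: w) + mould_mul (shift x M) N w.
Proof. by rewrite /mould_mul big_nat_recl. Qed.

Lemma mould_mulDl : left_distributive mould_mul +%R.
Proof.
move=> M N P; apply/funext => w; rewrite /mould_mul -[RHS]big_split /=.
by apply: eq_bigr => i _; rewrite mulrDl.
Qed.

Lemma mould_mulDr : right_distributive mould_mul +%R.
Proof.
move=> M N P; apply/funext => w; rewrite /mould_mul -[RHS]big_split /=.
by apply: eq_bigr => i _; rewrite mulrDr.
Qed.

Lemma mould_mulA : associative mould_mul.
Proof.
move=> M N P; apply/funext => w; elim: w M N => [|x w IHw] M N.
  by rewrite !mould_mul_nil mulrA.
rewrite !mould_mul_cons mulrDr IHw mould_mul_nil mulrA -addrA.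
congr (_ + _).
have -> : shift x (mould_mul M N) =
    M [::] *: shift x N + mould_mul (shift x M) N.
  by apply/funext => v; rewrite /shift mould_mul_cons.
rewrite mould_mulDl; congr (_ + _).
rewrite /mould_mul big_distrr; apply: eq_bigr => i _ /=; exact: mulrA.
Qed.

Lemma mould_mul1l : left_id mould1 mould_mul.
Proof.
move=> M; apply/funext => w; rewrite /mould_mul big_nat_recl //= take0 drop0.
rewrite mul1r big1_seq ?addr0 // => i; rewrite mem_index_iota => /= ltiw.
by case: w ltiw => // x w _; rewrite /mould1 /= mul0r.
Qed.

Lemma mould_mul1r : right_id mould1 mould_mul.
Proof.
move=> M; apply/funext => w; elim: w M => [|x w IHw] M.
  by rewrite mould_mul_nil mulr1.
by rewrite mould_mul_cons IHw mulr0 add0r.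
Qed.

Lemma mould1_neq0 : mould1 != 0.
Proof. by apply/eqP => /(congr1 (@^~ [::])) /eqP; rewrite oner_eq0. Qed.

HB.instance Definition _ := GRing.Zmodule_isNzRing.Build (mould T k)
  mould_mulA mould_mul1l mould_mul1r mould_mulDl mould_mulDr mould1_neq0.

Lemma mould_scaleAl (a : k) M N : a *: (M * N) = (a *: M) * N.
Proof.
apply/funext => w; rewrite /GRing.scale /= [LHS]big_distrr /=.
apply: eq_bigr => i _; exact: mulrA.
Qed.

HB.instance Definition _ :=
  GRing.Lmodule_isLalgebra.Build k (mould T k) mould_scaleAl.

Lemma mould_scaleAr (a : k) M N : a *: (M * N) = M * (a *: N).
Proof.
apply/funext => w; rewrite /GRing.scale /= [LHS]big_distrr /=.
apply: eq_bigr => i _; exact: mulrCA.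
Qed.

HB.instance Definition _ :=
  GRing.Lalgebra_isAlgebra.Build k (mould T k) mould_scaleAr.

Lemma mouldM M N w : (M * N) w =
  \sum_(0 <= i < (size w).+1) M (take i w) * N (drop i w).
Proof. by []. Qed.

Lemma mouldM_nil M N : (M * N) [::] = M [::] * N [::].
Proof. exact: mould_mul_nil. Qed.

Lemma mouldM_cons M N x w :
  (M * N) (x :: w) = M [::] * N (x :: w) + (shift x M * N) w.
Proof. exact: mould_mul_cons. Qed.

Lemma mould1E w : (1 : mould T k) w = (nilp w)%:R.
Proof. by []. Qed.

Lemma mouldD M N w : (M + N) w = M w + N w. Proof. by []. Qed.
Lemma mouldB M N w : (M - N) w = M w - N w. Proof. by []. Qed.
Lemma mouldZ (a : k) M w : (a *: M) w = a * M w. Proof. by []. Qed.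

Lemma mould_sumE (J : Type) (r : seq J) (P : pred J) (M : J -> mould T k) w :
  (\sum_(j <- r | P j) M j) w = \sum_(j <- r | P j) M j w.
Proof. by elim/big_rec2: _ => //= j a b _ <-. Qed.

Lemma mouldMn M n w : (M *+ n) w = M w *+ n.
Proof. by elim: n => [|n IHn] //; rewrite !mulrS -IHn. Qed.

Lemma shiftM x M N : shift x (M * N) = M [::] *: shift x N + shift x M * N.
Proof. by apply/funext => w; rewrite /shift mouldM_cons. Qed.

(** Recursive definitions of moulds sum over proper decompositions only; the
    two end terms turn them into equations in the algebra. *)
Lemma mouldM_star (M N : seq T -> k) w : w <> [::] ->
  ((M : mould T k) * (N : mould T k)) w =
  M [::] * N w + M w * N [::] +
  \sum_(1 <= i < size w) M (take i w) * N (drop i w).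
Proof.
move=> w0; have w_gt0 : (0 < size w)%N by case: w w0.
rewrite mouldM big_nat_recr //= big_ltn // take0 drop0 take_size drop_size.
by rewrite -addrA [X in _ + X]addrC addrA.
Qed.

Definition vanishes_below (r : nat) M := forall w, (size w < r)%N -> M w = 0.

Lemma vanishes_belowM p q M N :
  vanishes_below p M -> vanishes_below q N -> vanishes_below (p + q) (M * N).
Proof.
move=> M0 N0 w wpq; rewrite mouldM big1_seq // => i /andP[_].
rewrite mem_index_iota ltnS /= => leiw.
case: (ltnP i p) => [ip|pi]; first by rewrite M0 ?mul0r // size_takel.
by rewrite N0 ?mulr0 // size_drop; lia.
Qed.

Lemma vanishes_belowX n M : M [::] = 0 -> vanishes_below n (M ^+ n).
Proof.
move=> M0; elim: n => [|n IHn]; first by move=> w; rewrite ltn0.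
rewrite exprS -add1n; apply: vanishes_belowM => // -[].
by rewrite M0.
by [].
Qed.

Lemma vanishes_belowB r M N :
  vanishes_below r M -> vanishes_below r N -> vanishes_below r (M - N).
Proof. by move=> M0 N0 w wr; rewrite mouldB M0 ?N0 ?subr0. Qed.

(** Left division by a mould with constant term [1] is a triangular system,
    so equality of products on short words can be cancelled there. *)
Lemma mould_mulIl_below n (S M N : mould T k) : S [::] = 1 ->
  (forall w, (size w < n)%N -> (S * M) w = (S * N) w) ->
  forall w, (size w < n)%N -> M w = N w.
Proof.
move=> S0 SMN w; have [s] := ubnP (size w).
elim: s w => // s IHs w ws wn; have := SMN w wn.
rewrite !mouldM big_nat_recl // [in X in _ = X]big_nat_recl // take0 drop0 S0 !mul1r.
set a := \sum_(_ <= i < _) _; set b := \sum_(_ <= i < _) _.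
have -> : a = b; last by move/addIr.
apply: eq_big_nat => i /andP[_ iw]; rewrite IHs ?size_drop //; lia.
Qed.

(** It is a derivation when [wt] is additive; the weights of interest are the
    length of words and their total eigenvalue. *)
Definition derivation (wt : seq T -> k) M : mould T k := fun w => wt w * M w.

Lemma derivationM wt M N : (forall u v, wt (u ++ v) = wt u + wt v) ->
  derivation wt (M * N) = derivation wt M * N + M * derivation wt N.
Proof.
move=> wtD; apply/funext => w.
rewrite /derivation mouldD !mouldM big_distrr -big_split /=.
apply: eq_bigr => i _; rewrite -{1}(cat_take_drop i w) wtD; ring.
Qed.

End MouldRing.

(** * Shuffles *)

Section Shuffles.
Variables (T : Type) (k : fieldType).
Implicit Types (M N S : mould T k) (a b w : seq T).

Definition sh M a b : k := \sum_(w <- shuffles a b) M w.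

Lemma sh_nill M b : sh M [::] b = M b.
Proof. by rewrite /sh /= big_seq1. Qed.

Lemma shuffles_nilr a : shuffles a [::] = [:: a].
Proof. by case: a. Qed.

Lemma sh_nilr M a : sh M a [::] = M a.
Proof. by rewrite /sh shuffles_nilr big_seq1. Qed.

Lemma sh_cons M x a y b :
  sh M (x :: a) (y :: b) =
  sh (shift x M) a (y :: b) + sh (shift y M) (x :: a) b.
Proof. by rewrite /sh /= big_cat !big_map. Qed.

Lemma shD M N a b : sh (M + N) a b = sh M a b + sh N a b.
Proof. by rewrite /sh -big_split. Qed.

Lemma shB M N a b : sh (M - N) a b = sh M a b - sh N a b.
Proof. by rewrite /sh -sumrB. Qed.

Lemma shZ (c : k) M a b : sh (c *: M) a b = c * sh M a b.
Proof. by rewrite /sh big_distrr. Qed.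

Lemma sum_over_shuffles (R : nmodType) (f : seq T -> R) x a y b :
  \sum_(w <- shuffles (x :: a) (y :: b)) f w =
  \sum_(w <- shuffles a (y :: b)) f (x :: w) +
  \sum_(w <- shuffles (x :: a) b) f (y :: w).
Proof. by rewrite /= big_cat !big_map. Qed.

(** An additive weight is blind to the order of letters, hence constant on
    the shuffles of two given words. *)
Lemma shuffles_weight (R : nmodType) (f : k -> seq T -> R) wt a b :
  (forall u v, wt (u ++ v) = wt u + wt v) ->
  \sum_(w <- shuffles a b) f (wt w) w =
  \sum_(w <- shuffles a b) f (wt a + wt b) w.
Proof.
move=> wtD; have wt0 : wt [::] = 0.
  by apply: (addIr (wt [::])); rewrite -wtD add0r.
elim: a b f => [|x a IHa] b f; first by rewrite !big_seq1 wt0 add0r.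
elim: b f => [|y b IHb] f; first by rewrite !big_seq1 wt0 addr0.
have wt_cons z w : wt (z :: w) = wt [:: z] + wt w by rewrite -cat1s wtD.
rewrite !sum_over_shuffles; congr (_ + _).
  under eq_bigr do rewrite wt_cons.
  rewrite (IHa _ (fun c w => f (wt [:: x] + c) (x :: w))).
  by rewrite (wt_cons x a) addrA.
under eq_bigr do rewrite wt_cons.
rewrite (IHb (fun c w => f (wt [:: y] + c) (y :: w))).
by rewrite (wt_cons y b) addrCA.
Qed.

Lemma sh_derivation wt M a b : (forall u v, wt (u ++ v) = wt u + wt v) ->
  sh (derivation wt M) a b = (wt a + wt b) * sh M a b.
Proof.
move=> wtD; rewrite [RHS]big_distrr /=.
exact: (shuffles_weight (fun c w => c * M w)).
Qed.

Definition convolution (P Q : seq T -> seq T -> k) a b : k :=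
  \sum_(0 <= i < (size a).+1) \sum_(0 <= j < (size b).+1)
    P (take i a) (take j b) * Q (drop i a) (drop j b).

Lemma eq_convolution P P' Q Q' a b :
  (forall a b, P a b = P' a b) -> (forall a b, Q a b = Q' a b) ->
  convolution P Q a b = convolution P' Q' a b.
Proof.
by move=> PP QQ; apply: eq_bigr => i _; apply: eq_bigr => j _; rewrite PP QQ.
Qed.

(** Cutting a shuffle of [a] and [b] in two amounts to cutting [a] and [b] and
    shuffling the pieces: [sh] turns products into convolutions. *)
Lemma shM M N a b : sh (M * N) a b = convolution (sh M) (sh N) a b.
Proof.
elim: a b M => [|x a IHa] b M.
  rewrite sh_nill /convolution big_nat1; apply: eq_bigr => j _.
  by rewrite !sh_nill.
elim: b M => [|y b IHb] M.
  rewrite sh_nilr /convolution; apply: eq_bigr => i _.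
  by rewrite big_nat1 !sh_nilr.
rewrite sh_cons !shiftM !shD !shZ IHa IHb /convolution.
rewrite [in RHS]big_nat_recl // [in RHS]big_nat_recl //=.
rewrite [X in _ + (_ + X) = _]big_nat_recl //= sh_nill sh_cons.
under [X in _ = _ + _ + X]eq_bigr => i _.
  rewrite big_nat_recl //= sh_nilr.
  under eq_bigr do rewrite sh_cons mulrDl.
  rewrite big_split /=; over.
rewrite !big_split /=.
under eq_bigr => i _.
  rewrite big_nat_recl //= sh_nilr; over.
rewrite big_split /=.
under [X in _ = _ + X + _]eq_bigr do rewrite sh_nill.
under [X in _ + (_ + (X + _)) = _]eq_bigr do rewrite sh_nill.
rewrite /shift; ring.
Qed.


Lemma convolution_tensor P P' Q Q' a b :
  convolution (fun a b => P a * P' b) (fun a b => Q a * Q' b) a b =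
  ((P : mould T k) * Q) a * ((P' : mould T k) * Q') b.
Proof.
rewrite !mouldM big_distrl; apply: eq_bigr => i _.
rewrite big_distrr; apply: eq_bigr => j _ /=; ring.
Qed.

Lemma convolutionDl P P' Q a b :
  convolution (fun a b => P a b + P' a b) Q a b =
  convolution P Q a b + convolution P' Q a b.
Proof.
rewrite /convolution -big_split; apply: eq_bigr => i _.
by rewrite -big_split; apply: eq_bigr => j _; rewrite mulrDl.
Qed.

Lemma convolutionDr P Q Q' a b :
  convolution P (fun a b => Q a b + Q' a b) a b =
  convolution P Q a b + convolution P Q' a b.
Proof.
rewrite /convolution -big_split; apply: eq_bigr => i _.
by rewrite -big_split; apply: eq_bigr => j _; rewrite mulrDr.
Qed.

Definition symmetral M :=
  M [::] = 1 /\ forall a b, sh M a b = M a * M b.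

(** Alternality, in a form that also covers empty words and reads as
    [sh M = M (x) 1 + 1 (x) M]. *)
Definition primitive M :=
  forall a b, sh M a b = M a * (1 : mould T k) b + (1 : mould T k) a * M b.

Lemma primitive_nil M : primitive M -> M [::] = 0.
Proof.
move=> /(_ [::] [::]); rewrite sh_nill mould1E mulr1 mul1r => h.
by apply: (addIr (M [::])); rewrite add0r -h.
Qed.

Lemma primitiveP M : primitive M <-> M [::] = 0 /\
  forall a b, a <> [::] -> b <> [::] -> sh M a b = 0.
Proof.
split=> [altM|[M0 altM] [|x a] [|y b]].
- split=> [|[|x a] [|y b] //= _ _]; first exact: primitive_nil.
  by rewrite altM !mould1E mulr0 mul0r addr0.
- by rewrite sh_nill M0 mul0r mulr0 addr0.
- by rewrite sh_nill !mould1E mulr0 mul1r add0r.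
- by rewrite sh_nilr !mould1E mulr1 mul0r addr0.
by rewrite altM // !mould1E mulr0 mul0r addr0.
Qed.

Lemma symmetral1 : symmetral 1.
Proof.
split=> // -[|x a] [|y b]; rewrite ?sh_nill ?sh_nilr ?mulr1 ?mul1r //.
rewrite sh_cons !mould1E mulr0 /sh !big1 ?addr0 //.
Qed.

Lemma symmetralM M N : symmetral M -> symmetral N -> symmetral (M * N).
Proof.
move=> [M0 symM] [N0 symN]; split; first by rewrite mouldM_nil M0 N0 mulr1.
by move=> a b; rewrite shM (eq_convolution a b symM symN) convolution_tensor.
Qed.

Lemma symmetralX M n : symmetral M -> symmetral (M ^+ n).
Proof.
move=> symM; elim: n => [|n IHn]; first by rewrite expr0; exact: symmetral1.
by rewrite exprS; apply: symmetralM.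
Qed.

Lemma primitiveB M N : primitive M -> primitive N -> primitive (M - N).
Proof. by move=> pM pN a b; rewrite shB pM pN !mouldB; ring. Qed.

Lemma primitive_derivation wt M : (forall u v, wt (u ++ v) = wt u + wt v) ->
  primitive M -> primitive (derivation wt M).
Proof.
move=> wtD /primitiveP[M0 pM]; apply/primitiveP.
split=> [|a b a0 b0]; first by rewrite /derivation M0 mulr0.
by rewrite sh_derivation // pM // mulr0.
Qed.

(** [sh (M * N)] is [M * N] against [1], plus a part that is symmetric in
    [M] and [N] and cancels in the commutator. *)
Lemma primitive_commutator M N :
  primitive M -> primitive N -> primitive (M * N - N * M).
Proof.
have shMN M' N' (pM : primitive M') (pN : primitive N') a b :
    sh (M' * N') a b = (M' * N') a * (1 : mould T k) b + M' a * N' b +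
      (N' a * M' b + (1 : mould T k) a * (M' * N') b).
  rewrite shM (eq_convolution a b pM pN) !convolutionDl !convolutionDr.
  by rewrite !convolution_tensor !mul1r !mulr1.
by move=> pM pN a b; rewrite shB !shMN // !mouldB; ring.
Qed.

(** The associated series is the sum of the family [B] itself. *)
Definition letter : mould T k := fun w => (size w == 1)%:R.

Lemma shift_letter x : shift x letter = 1.
Proof. by apply/funext; case. Qed.

Lemma primitive_letter : primitive letter.
Proof.
apply/primitiveP; split=> // -[|x a] [|y b] // _ _.
by rewrite sh_cons !shift_letter !symmetral1.2 !mould1E mulr0 mul0r addr0.
Qed.

Lemma letterM_cons M x w : (letter * M) (x :: w) = M w.
Proof. by rewrite mouldM_cons mul0r add0r shift_letter mul1r. Qed.

(** The induction step for the symmetry of a quotient: if [S] is symmetral and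
    [M] alternal on shorter pairs of words, [sh (S * M)] differs from its
    expected value by the term in which [S] sees only empty words. *)
Lemma shM_step S M a b : S [::] = 1 -> M [::] = 0 ->
  a <> [::] -> b <> [::] ->
  (forall a' b', (size a' + size b' < size a + size b)%N ->
     sh S a' b' = S a' * S b') ->
  (forall a' b', (size a' + size b' < size a + size b)%N ->
     sh M a' b' = M a' * (1 : mould T k) b' + (1 : mould T k) a' * M b') ->
  sh (S * M) a b = sh M a b + (S * M) a * S b + S a * (S * M) b.
Proof.
move=> S0 M0 a0 b0 symS altM.
pose Q u v := M u * (1 : mould T k) v + (1 : mould T k) u * M v.
rewrite -addrA.
have <- : convolution (fun a b => S a * S b) Q a b =
    (S * M) a * S b + S a * (S * M) b.
  by rewrite convolutionDr !convolution_tensor !mulr1.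
have <- : \sum_(0 <= i < (size a).+1) \sum_(0 <= j < (size b).+1)
    (if (i == 0%N) && (j == 0%N) then sh M a b else 0) = sh M a b.
  rewrite big_nat_recl // big_nat_recl //= big1 // addr0.
  by rewrite big1 ?addr0 // => i _; rewrite big1.
rewrite shM /convolution -big_split /=; apply: eq_big_nat => i /andP[_ ia].
rewrite -big_split /=; apply: eq_big_nat => j /andP[_ jb].
have a_gt0 : (0 < size a)%N by case: (a) a0.
have b_gt0 : (0 < size b)%N by case: (b) b0.
have sta : (size (take i a) <= i)%N by rewrite size_take; case: ifP; lia.
have stb : (size (take j b) <= j)%N by rewrite size_take; case: ifP; lia.
case: ifP => [/andP[/eqP-> /eqP->]|ij].
  rewrite !take0 !drop0 sh_nill S0 /Q !mould1E !mul1r.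
  by case: (a) (b) a0 b0 => [|x a'] [|y b'] //= _ _; rewrite mulr0 mul0r !addr0.
rewrite add0r; case: (boolP ((i == size a) && (j == size b))).
  move=> /andP[/eqP-> /eqP->]; rewrite !take_size !drop_size.
  by rewrite sh_nill /Q M0 !mul0r !mulr0 addr0 mulr0.
by move=> ij'; rewrite symS ?altM ?size_drop //; lia.
Qed.

End Shuffles.

Section ChangeOfAlphabet.
Variables (I T : Type) (k : fieldType) (f : I -> T).
Implicit Types M N : mould T k.

Definition pullback M : mould I k := fun w => M (map f w).

Lemma pullbackM M N : pullback (M * N) = pullback M * pullback N.
Proof.
apply/funext => w; rewrite /pullback !mouldM size_map.
by apply: eq_bigr => i _; rewrite map_take map_drop.
Qed.

Lemma pullbackX M n : pullback (M ^+ n) = pullback M ^+ n.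
Proof.
elim: n => [|n IHn]; last by rewrite !exprS pullbackM IHn.
by apply/funext; case.
Qed.

Lemma pullback_letter : pullback (letter k) = letter k.
Proof. by apply/funext => w; rewrite /pullback /letter size_map. Qed.

Lemma sh_pullback M a b : sh (pullback M) a b = sh M (map f a) (map f b).
Proof.
elim: a b M => [|x a IHa] b M; first by rewrite !sh_nill.
elim: b M => [|y b IHb] M; first by rewrite !sh_nilr.
rewrite sh_cons /= [RHS]sh_cons; congr (_ + _); first exact: (IHa (y :: b)).
exact: (IHb (shift (f y) M)).
Qed.

Lemma primitive_pullback M : primitive M -> primitive (pullback M).
Proof.
by move=> pM a b; rewrite sh_pullback pM !mould1E /nilp !size_map.
Qed.

End ChangeOfAlphabet.

(** * The normalizing moulds *)

Section NormalizingMoulds.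
Variable k : fieldType.
Implicit Types (A S F N G : mould k k) (w : seq k).

Lemma sigmaD u v : sigma (u ++ v) = sigma u + sigma v :> k.
Proof. by rewrite /sigma big_cat. Qed.

Lemma sizeD_natr (u v : seq k) : (size (u ++ v))%:R =
  (size u)%:R + (size v)%:R :> k.
Proof. by rewrite size_cat natrD. Qed.

Lemma mouldM_starE (M N : seq k -> k) w : w <> [::] ->
  ((M : mould k k) * (N : mould k k)) w =
  M [::] * N w + M w * N [::] + star M N w.
Proof. exact: mouldM_star. Qed.

Section Existence.
Variable A : mould k k.

Definition normalizing_step (T : seq k -> k * k * k) w : k * k * k :=
  let S v := (T v).1.1 in let F v := (T v).1.2 in let N v := (T v).2 in
  if nilp w then (1, 0, 0)
  else if sigma w != 0 then
    let s := (sigma w)^-1 * (S (behead w) - star S F w) in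
    (s, 0, (size w)%:R * s - star S N w)
  else ((size w)%:R^-1 * (A w + star S N w),
        S (behead w) - star S F w, A w).

(** The values at [w] only involve values at shorter words, so that
    [(size w).+1] iterations of the defining equations reach them from any
    initial values. *)
Definition normalizing_triple w : k * k * k :=
  iter (size w).+1 normalizing_step (fun=> (0, 0, 0)) w.

Lemma normalizing_step_local T T' w :
  (forall v, (size v < size w)%N -> T v = T' v) ->
  normalizing_step T w = normalizing_step T' w.
Proof.
move=> TT'; rewrite /normalizing_step; case: nilP => // w0.
have w_gt0 : (0 < size w)%N by case: (w) w0.
have eq_star (f g : k * k * k -> k) : star (f \o T) (g \o T) w =
    star (f \o T') (g \o T') w.
  apply: eq_big_nat => i /andP[i_gt0 iw] /=.
  by rewrite !TT' ?size_drop ?size_take ?iw //; lia.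
rewrite TT' ?size_behead ?prednK //.
by rewrite (eq_star (fun p => p.1.1) snd) (eq_star (fun p => p.1.1) (fun p => p.1.2)).
Qed.

Lemma normalizing_iter_stable T T' m m' w : (size w < m)%N -> (size w < m')%N ->
  iter m normalizing_step T w = iter m' normalizing_step T' w.
Proof.
elim: m m' w => // m IHm [|m'] // w wm wm'.
by rewrite !iterS; apply: normalizing_step_local => v vw; apply: IHm; lia.
Qed.

Lemma normalizing_tripleE w :
  normalizing_triple w = normalizing_step normalizing_triple w.
Proof.
rewrite /normalizing_triple iterS; apply: normalizing_step_local => v vw.
exact: normalizing_iter_stable.
Qed.

Lemma normalizing_moulds_exist :
  exists S F N G : mould k k, normalizing_moulds A S F N G.
Proof.
exists (fun w => (normalizing_triple w).1.1).
exists (fun w => (normalizing_triple w).1.2).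
exists (fun w => (normalizing_triple w).2).
exists (fun w => \sum_(1 <= j < (size w).+1) (-1) ^+ j.-1 / j%:R *
  star_pow (fun w => (normalizing_triple w).1.1) j w).
split=> //.
- move=> w w0 sw; rewrite !(normalizing_tripleE w).
  by rewrite /normalizing_step; case: nilP => //; rewrite sw.
- move=> w w0 sw; rewrite !(normalizing_tripleE w).
  by rewrite /normalizing_step sw eqxx /=; case: nilP.
Qed.

End Existence.

Section Symmetrality.
Hypothesis chark0 : [pchar k] =i pred0.
Variables (A S F N G : mould k k).
Hypothesis altA : alternal A.
Hypothesis nSFNG : normalizing_moulds A S F N G.

Lemma resonant_F : derivation (@sigma k) F = 0.
Proof.
apply/funext => w; rewrite /derivation; have [->|sw] := eqVneq (sigma w) 0.
  by rewrite mul0r.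
have w0 : w <> [::] by move=> w0; rewrite w0 /sigma big_nil eqxx in sw.
by have [-> _ _] := mould_nonresonant nSFNG w0 sw; rewrite mulr0.
Qed.

Lemma mould_N_resonant w : sigma w = 0 -> N w = A w.
Proof.
move=> sw; have [->|/eqP w0] := eqVneq w [::].
  by rewrite (mould_N0 nSFNG) altA.1.
by have [] := mould_resonant nSFNG w0 sw.
Qed.

Lemma letterM_behead M w : w <> [::] -> (letter k * M) w = M (behead w).
Proof. by case: w => // x w _; exact: letterM_cons. Qed.

(** The two clauses for [S] and [F] are one equation of moulds. *)
Lemma derivation_sigma_S : derivation (@sigma k) S = letter k * S - S * F.
Proof.
apply/funext => w; rewrite mouldB; have [->|/eqP w0] := eqVneq w [::].
  by rewrite !mouldM_nil (mould_F0 nSFNG) /derivation /sigma big_nil !mul0r mulr0 subr0.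
rewrite letterM_behead // mouldM_starE // (mould_S0 nSFNG) (mould_F0 nSFNG).
rewrite mulr0 addr0 mul1r /derivation.
have [sw|sw] := eqVneq (sigma w) 0.
  have [-> _ _] := mould_resonant nSFNG w0 sw; rewrite sw; ring.
have [-> -> _] := mould_nonresonant nSFNG w0 sw.
by rewrite mulVKf // add0r.
Qed.

Lemma natf_neq0_char0 n : (n.+1%:R != 0 :> k).
Proof. by rewrite (pcharf0P k).1. Qed.

Lemma derivation_size_S : derivation (fun w => (size w)%:R) S = S * N.
Proof.
apply/funext => w; have [->|/eqP w0] := eqVneq w [::].
  by rewrite mouldM_nil (mould_N0 nSFNG) mulr0 /derivation mul0r.
rewrite mouldM_starE // (mould_S0 nSFNG) (mould_N0 nSFNG).
rewrite mulr0 addr0 mul1r /derivation.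
have [sw|sw] := eqVneq (sigma w) 0; last first.
  by have [_ _ ->] := mould_nonresonant nSFNG w0 sw; rewrite subrK.
have [_ -> ->] := mould_resonant nSFNG w0 sw.
by rewrite mulVKf //; case: (w) w0 => // x v _; exact: natf_neq0_char0.
Qed.

(** With [s = sigma a + sigma b], [r = size a + size b] and
    [e = sh S a b - S a * S b], the two mould equations give
    [s * e + sh F a b = 0] and [r * e = sh N a b].  If [s <> 0] then
    [sh F a b = 0] by resonance of [F], hence [e = 0]; if [s = 0] then
    [sh N a b = sh A a b = 0], hence [e = 0] as [r] is invertible. *)
Lemma normalizing_symmetries a b :
  [/\ sh S a b = S a * S b,
      sh F a b = F a * (1 : mould k k) b + (1 : mould k k) a * F b
    & sh N a b = N a * (1 : mould k k) b + (1 : mould k k) a * N b].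
Proof.
have [n] := ubnP (size a + size b); elim: n a b => // n IHn a b abn.
have S0 := mould_S0 nSFNG; have F0 := mould_F0 nSFNG.
have N0 := mould_N0 nSFNG.
have [-> |/eqP a0] := eqVneq a [::].
  rewrite !sh_nill S0 F0 N0 !mul0r !add0r !mul1r; split=> //.
have [-> |/eqP b0] := eqVneq b [::].
  by rewrite !sh_nilr S0 F0 N0 !mulr0 !addr0 !mulr1.
have IH a' b' (lt_ab : (size a' + size b' < size a + size b)%N) :=
  IHn a' b' (leq_trans lt_ab abn).
have symS a' b' : (size a' + size b' < size a + size b)%N ->
    sh S a' b' = S a' * S b'.
  by case/IH.
have stepF : sh (S * F) a b = sh F a b + (S * F) a * S b + S a * (S * F) b.
  by apply: shM_step => // a' b' /IH[].
have stepN : sh (S * N) a b = sh N a b + (S * N) a * S b + S a * (S * N) b.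
  by apply: shM_step => // a' b' /IH[].
have stepI : sh (letter k * S) a b =
    (letter k * S) a * S b + S a * (letter k * S) b.
  have shiftI x : shift x (letter k * S) = S.
    by apply/funext => w; rewrite /shift letterM_cons.
  case: (a) (b) a0 b0 symS => [|x a'] [|y b'] // _ _ symS.
  rewrite sh_cons !shiftI !letterM_cons !symS //=; lia.
have eqF := derivation_sigma_S; have eqN := derivation_size_S.
have rel_F : (sigma a + sigma b) * (sh S a b - S a * S b) + sh F a b = 0.
  have := congr1 (fun M => sh M a b) eqF.
  rewrite /= shB sh_derivation; last exact: sigmaD.
  rewrite stepF stepI.
  (* Eliminate the weights of [a] and [b] using the equation at each of them. *)
  have := congr1 (fun M : mould k k => M a) eqF.
  have := congr1 (fun M : mould k k => M b) eqF.
  rewrite !mouldB /derivation => /eqP; rewrite eq_sym subr_eq => /eqP->.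
  move=> /eqP; rewrite eq_sym subr_eq => /eqP-> h.
  rewrite mulrBr h; ring.
have rel_N : ((size a)%:R + (size b)%:R) * (sh S a b - S a * S b) = sh N a b.
  have := congr1 (fun M => sh M a b) eqN.
  rewrite /= sh_derivation; last exact: sizeD_natr.
  rewrite stepN -eqN /derivation mulrBr => ->; ring.
have e0 : sh S a b = S a * S b -> sh F a b = 0 /\ sh N a b = 0.
  move=> e; rewrite e subrr !mulr0 add0r in rel_F rel_N.
  by rewrite rel_F -rel_N.
have symSab : sh S a b = S a * S b; last first.
  have [-> ->] := e0 symSab; split=> //.
    by case: (a) (b) a0 b0 => [|x a'] [|y b'] // _ _; rewrite mulr0 mul0r addr0.
  by case: (a) (b) a0 b0 => [|x a'] [|y b'] // _ _; rewrite mulr0 mul0r addr0.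
apply/eqP; rewrite -subr_eq0; have [sab|sab] := eqVneq (sigma a + sigma b) 0.
  have shN0 : sh N a b = 0.
    rewrite -(altA.2 a b a0 b0).
    have := shuffles_weight (fun s w => if s == 0 then N w else 0) a b sigmaD.
    have := shuffles_weight (fun s w => if s == 0 then A w else 0) a b sigmaD.
    rewrite sab eqxx /sh => <- <-; apply: eq_bigr => w _.
    by case: eqP => // /mould_N_resonant.
  move: rel_N; rewrite shN0 -natrD => /eqP; rewrite mulf_eq0.
  case: (a) a0 => // x a' _.
  by rewrite /= addSn (negbTE (natf_neq0_char0 _)).
have shF0 : sh F a b = 0.
  apply/eqP; have := sh_derivation F a b sigmaD.
  rewrite resonant_F /sh big1 // => /esym/eqP.
  by rewrite mulf_eq0 (negbTE sab).
by move/eqP: rel_F; rewrite shF0 addr0 mulf_eq0 (negbTE sab).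
Qed.

Lemma symmetral_S : symmetral S.
Proof.
split; first exact: mould_S0 nSFNG.
by move=> a b; have [] := normalizing_symmetries a b.
Qed.

End Symmetrality.
End NormalizingMoulds.

(** * Logarithm of a symmetral mould *)

Section BinomialPolynomials.
Variable k : fieldType.
Hypothesis chark0 : [pchar k] =i pred0.

Definition binomial_poly (j : nat) : {poly k} :=
  (j`!%:R)^-1 *: \prod_(0 <= i < j) ('X - i%:R%:P).

Lemma fact_neq0_char0 n : (n`!%:R != 0 :> k).
Proof. by rewrite (pcharf0P k).1 // -lt0n fact_gt0. Qed.

Lemma horner_binomial_poly j n : (binomial_poly j).[n%:R] = 'C(n, j)%:R.
Proof.
rewrite hornerZ horner_prod.
have -> : \prod_(0 <= i < j) ('X - i%:R%:P).[n%:R] = (n ^_ j)%:R :> k.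
  elim: j => [|j IHj]; first by rewrite big_nil ffactn0.
  rewrite big_nat_recr //= IHj ffactnSr natrM !hornerE.
  have [jn|nj] := leqP j n; first by rewrite natrB.
  by rewrite ffact_small // !mul0r.
by rewrite -bin_ffact natrM mulrC mulfK // fact_neq0_char0.
Qed.

Lemma binomial_poly0_coef1 : (binomial_poly 0)`_1 = 0.
Proof. by rewrite /binomial_poly big_nil coefZ coef1 mulr0. Qed.

(** The linear coefficients of [binom(t, j)] are those of [log (1 + x)]. *)
Lemma binomial_poly_coef1 j :
  (binomial_poly j.+1)`_1 = (-1) ^+ j / j.+1%:R.
Proof.
rewrite /binomial_poly big_nat_recl //= subr0 coefZ coefXM /= -horner_coef0.
rewrite horner_prod.
have -> : \prod_(0 <= i < j) ('X - i.+1%:R%:P).[0] = (-1) ^+ j * j`!%:R :> k.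
  elim: j => [|j IHj]; first by rewrite big_nil mulr1.
  by rewrite big_nat_recr //= IHj !hornerE factS natrM exprS; ring.
have := fact_neq0_char0 j; have : j.+1%:R != 0 :> k by rewrite (pcharf0P k).1.
by rewrite factS natrM; move: (_.+1%:R) (_`!%:R) => a b a0 b0; field; rewrite a0.
Qed.

Lemma eq_poly_nat (p q : {poly k}) :
  (forall n : nat, p.[n%:R] = q.[n%:R]) -> p = q.
Proof.
move=> pq; apply/eqP; rewrite -subr_eq0; apply/negPn/negP => r0.
pose s : seq k := [seq n%:R | n <- iota 0 (size (p - q))].
have rs : all (root (p - q)) s.
  by apply/allP => _ /mapP[n _ ->]; rewrite rootE !hornerE pq subrr.
have us : uniq s.
  rewrite map_inj_uniq ?iota_uniq // => m n /eqP.
  wlog mn : m n / (m <= n)%N.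
    move=> th; have [/th//|/ltnW/th{}th] := leqP m n.
    by rewrite eq_sym => /th.
  by rewrite eq_sym -subr_eq0 -natrB // (pcharf0P k).1 // subn_eq0 => nm;
    apply/eqP; rewrite eqn_leq mn.
by have := max_poly_roots r0 rs us; rewrite size_map size_iota ltnn.
Qed.

End BinomialPolynomials.

Section MouldLogarithm.
Variables (T : Type) (k : fieldType).
Hypothesis chark0 : [pchar k] =i pred0.
Variable S : mould T k.
Hypothesis symS : symmetral S.

Let S0 : S [::] = 1 := symS.1.

Lemma sub1_nil : (S - 1) [::] = 0.
Proof. by rewrite mouldB S0 subrr. Qed.

(** The value at [w] of the binomial expansion of [(1 + (S - 1)) ^ t], as a
    polynomial in the exponent [t]. *)
Definition power_poly (w : seq T) : {poly k} :=
  \sum_(0 <= j < (size w).+1) ((S - 1) ^+ j) w *: binomial_poly k j.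

Lemma horner_power_poly w n : (power_poly w).[n%:R] = (S ^+ n) w.
Proof.
rewrite /power_poly horner_sum.
under eq_bigr do rewrite hornerZ horner_binomial_poly //.
rewrite -[X in X ^+ n](subrK 1) exprD1n mould_sumE.
rewrite -(big_mkord xpredT (fun i => (((S - 1) ^+ i) *+ 'C(n, i)) w)).
under [RHS]eq_bigr do rewrite mouldMn -mulr_natr.
pose f i : k := ((S - 1) ^+ i) w * 'C(n, i)%:R.
rewrite -/(\sum_(0 <= i < _) f i) -/(\sum_(0 <= i < n.+1) f i).
have pad a b : (a <= b)%N -> (forall i, (a <= i < b)%N -> f i = 0) ->
    \sum_(0 <= i < b) f i = \sum_(0 <= i < a) f i.
  move=> ab f0; rewrite (big_cat_nat _ ab) //= [X in _ + X]big1_seq ?addr0 //.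
  by move=> i /andP[_]; rewrite mem_index_iota => /f0.
have [wn|nw] := leqP (size w) n.
  rewrite [RHS](pad (size w).+1) // => i /andP[wi _].
  by rewrite /f (vanishes_belowX sub1_nil) ?mul0r.
rewrite (pad n.+1) // => [|i /andP[ni _]]; first exact: ltnW.
by rewrite /f bin_small // mulr0.
Qed.

Lemma power_poly_coef0 w : (power_poly w)`_0 = (1 : mould T k) w.
Proof. by rewrite -horner_coef0 (horner_power_poly w 0). Qed.

(** [log S] is the derivative of [S ^ t] at [t = 0]. *)
Definition log_mould w : k := (power_poly w)`_1.

Lemma log_mouldE w : log_mould w =
  \sum_(1 <= j < (size w).+1) (-1) ^+ j.-1 / j%:R * ((S - 1) ^+ j) w.
Proof.
rewrite /log_mould coef_sum big_nat_recl // coefZ binomial_poly0_coef1 mulr0 add0r.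
rewrite big_add1 /=; apply: eq_bigr => j _.
by rewrite coefZ binomial_poly_coef1 // mulrC.
Qed.

(** Every power [S ^ n] is symmetral, hence
    [\sum_w power_poly w = power_poly a * power_poly b] over the shuffles [w]
    of [a] and [b]; when both are nonempty, the right-hand side has no linear
    term. *)
Lemma primitive_log_mould : primitive log_mould.
Proof.
apply/primitiveP; split.
  by rewrite /log_mould /power_poly big_nat1 coefZ binomial_poly0_coef1 mulr0.
move=> a b a0 b0; rewrite /sh -coef_sum.
have -> : \sum_(w <- shuffles a b) power_poly w = power_poly a * power_poly b.
  apply: (eq_poly_nat chark0) => n; rewrite horner_sum hornerM.
  rewrite !horner_power_poly -(symmetralX n symS).2.
  by apply: eq_bigr => w _; rewrite horner_power_poly.
rewrite coefM big_ord_recl big_ord1 /= !power_poly_coef0 !mould1E.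
by case: (a) (b) a0 b0 => [|x a'] [|y b'] // _ _; rewrite mul0r mulr0 addr0.
Qed.

(** Differentiating [S ^ (t + s) = S ^ t * S ^ s] in [s] at [s = 0]. *)
Lemma deriv_power_poly w : (power_poly w)^`() =
  \sum_(0 <= i < (size w).+1) log_mould (drop i w) *: power_poly (take i w).
Proof.
apply: (eq_poly_nat chark0) => n.
have shiftE : power_poly w \Po ('X + n%:R%:P) =
    \sum_(0 <= i < (size w).+1)
      (S ^+ n) (take i w) *: power_poly (drop i w).
  apply: (eq_poly_nat chark0) => m.
  rewrite horner_comp hornerD hornerX hornerC -natrD horner_power_poly horner_sum.
  rewrite addnC exprD mouldM; apply: eq_bigr => i _.
  by rewrite hornerZ horner_power_poly.
have := congr1 (fun p : {poly k} => p`_1) shiftE.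
rewrite /= -[LHS](mulr1n) -coef_deriv deriv_comp derivD derivX derivC addr0 mulr1.
rewrite -horner_coef0 horner_comp !hornerE => ->.
rewrite coef_sum horner_sum; apply: eq_bigr => i _.
by rewrite coefZ hornerZ horner_power_poly mulrC.
Qed.

Lemma power_poly_coef r w :
  (power_poly w)`_r *+ r`! = ((log_mould : mould T k) ^+ r) w.
Proof.
elim: r w => [|r IHr] w; first by rewrite power_poly_coef0.
rewrite factS mulrnA -coef_deriv deriv_power_poly coef_sum exprSr mouldM.
rewrite -sumrMnl; apply: eq_bigr => i _.
by rewrite coefZ -IHr mulrnAl mulrC.
Qed.

(** By [deriv_power_poly] the coefficients of [power_poly] follow the recursion
    of the exponential series of [log_mould]; take [t = 1]. *)
Lemma exp_log_mould n w : (size w < n)%N ->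
  S w = (\sum_(0 <= r < n) (r`!%:R)^-1 *: (log_mould : mould T k) ^+ r) w.
Proof.
move=> wn; have log0 : log_mould [::] = 0 := primitive_nil primitive_log_mould.
have coefE r : (power_poly w)`_r = (r`!%:R)^-1 * ((log_mould : mould T k) ^+ r) w.
  by rewrite -power_poly_coef -[_`_r *+ _]mulr_natl mulKf ?fact_neq0_char0.
have -> : S w = (power_poly w).[1%:R] by rewrite horner_power_poly expr1.
rewrite (@horner_coef_wide _ n); last first.
  apply/leq_sizeP => r nr; rewrite coefE (vanishes_belowX log0) ?mulr0 //.
  exact: leq_trans nr.
rewrite mould_sumE big_mkord; apply: eq_bigr => r _.
by rewrite expr1n mulr1 coefE.
Qed.

End MouldLogarithm.

Lemma star_powE (k : fieldType) (S : mould k k) j w : S [::] = 1 ->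
  star_pow S j w = ((S - 1) ^+ j) w.
Proof.
move=> S0; elim: j w => [|j IHj] w; first by rewrite expr0 mould1E; case: w.
rewrite exprS mouldM big_ltn // take0 mouldB S0 subrr mul0r add0r /=.
apply: eq_big_nat => i /andP[i_gt0 iw]; rewrite IHj mouldB mould1E.
by case: w i iw i_gt0 => [|x w] [|i] //= _ _; rewrite subr0.
Qed.

(** * Conjugation by the exponential of a mould *)

(** The [if] form matches products of truncated series, whose terms of high
    total degree are negligible. *)
Lemma sum_triangle (V : nmodType) (m : nat) (f : nat -> nat -> V) :
  \sum_(0 <= p < m) \sum_(0 <= q < m) (if (p + q < m)%N then f p q else 0) =
  \sum_(0 <= n < m) \sum_(0 <= p < n.+1) f p (n - p)%N.
Proof.
transitivity (\sum_(0 <= p < m) \sum_(0 <= q < m - p) f p q).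
  apply: eq_big_nat => p /andP[_ pm].
  rewrite (@big_cat_nat _ _ _ (m - p)%N) ?leq_subr //= [X in _ + X]big1_seq.
    rewrite addr0; apply: eq_big_nat => q /andP[_ qmp].
    by rewrite ifT //; lia.
  by move=> q /andP[_]; rewrite mem_index_iota => mpq; rewrite ifF //; lia.
elim: m => [|m IHm]; first by rewrite !big_nil.
rewrite [RHS]big_nat_recr //= -IHm.
rewrite [X in X + _](_ : _ = \sum_(0 <= p < m.+1) \sum_(0 <= q < m - p) f p q).
  rewrite -big_split /=; apply: eq_big_nat => p /andP[_ pm].
  by rewrite subSn // big_nat_recr.
by rewrite big_nat_recr //= subnn [X in _ + X]big_nil addr0.
Qed.

Section Conjugation.
Variables (T : Type) (k : fieldType).
Hypothesis chark0 : [pchar k] =i pred0.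
Variable wt : seq T -> k.
Hypothesis wtD : forall u v, wt (u ++ v) = wt u + wt v.
Variable G : mould T k.
Hypothesis pG : primitive G.

(** Iterated commutators with [G] of [letter - derivation wt], the second
    term being seen as an operator on moulds: its commutator with the left
    multiplication by [G] is that by [derivation wt G], so that from
    [r = 1] on they are moulds.  The operator itself, which stands for the
    bracket with [X0], is left out of the initial value. *)
Fixpoint conj_mould (r : nat) : mould T k :=
  if r is r'.+1 then
    conj_mould r' * G - G * conj_mould r' -
    (if r' == 0%N then derivation wt G else 0)
  else letter k.

Arguments conj_mould : simpl never.

Lemma conj_mouldS r : conj_mould r.+1 =
  conj_mould r * G - G * conj_mould r -
  (if r == 0%N then derivation wt G else 0).
Proof. by []. Qed.

Lemma primitive_conj_mould r : primitive (conj_mould r).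
Proof.
elim: r => [|r IHr]; first exact: primitive_letter.
rewrite conj_mouldS; apply: primitiveB; first exact: primitive_commutator.
case: r {IHr} => [|r]; first exact: primitive_derivation.
by move=> a b; rewrite /sh big1 // mul0r mulr0 addr0.
Qed.

Lemma conj_mould_vanishes r : vanishes_below r (conj_mould r).
Proof.
have G1 : vanishes_below 1 G by case=> // _; exact: primitive_nil.
elim: r => [|r IHr]; first by move=> w; rewrite ltn0.
rewrite conj_mouldS; apply: vanishes_belowB; last first.
  by case: (r == _) / eqP => [->|_] // w w1; rewrite /derivation G1 ?mulr0.
apply: vanishes_belowB; first by rewrite -addn1; exact: vanishes_belowM.
by rewrite -add1n; exact: vanishes_belowM.
Qed.

Lemma derivation1 : derivation wt 1 = 0.
Proof.
apply/funext => -[|x w]; last by rewrite /derivation mould1E mulr0.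
by rewrite /derivation mulr1; apply: (addIr (wt [::])); rewrite -wtD add0r.
Qed.

Lemma derivation_sum (J : Type) (r : seq J) (M : J -> mould T k) :
  derivation wt (\sum_(j <- r) M j) = \sum_(j <- r) derivation wt (M j).
Proof.
apply/funext => w; rewrite /derivation !mould_sumE big_distrr; exact: eq_bigr.
Qed.

Lemma derivationZ (c : k) (M : mould T k) :
  derivation wt (c *: M) = c *: derivation wt M.
Proof. by apply/funext => w; rewrite /derivation !mouldZ mulrCA. Qed.

(** The binomial formula for [D x^n] in terms of [x^(n-r) ad^r(D)], where [D]
    is [letter - derivation wt]. *)
Lemma conj_mould_binomial n :
  letter k * G ^+ n - derivation wt (G ^+ n) =
  \sum_(0 <= r < n.+1) (G ^+ (n - r) * conj_mould r) *+ 'C(n, r).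
Proof.
elim: n => [|n IHn].
  by rewrite big_nat1 expr0 derivation1 mulr1 mul1r subr0.
rewrite exprSr derivationM // mulrA opprD addrA -mulrBl IHn.
rewrite mulr_suml [in LHS]big_nat_recl //= [in RHS]big_nat_recl //= !subn0 !bin0 !mulr1n.
have conjE r : conj_mould r.+1 * G = conj_mould r.+2 + G * conj_mould r.+1.
  by rewrite [conj_mould r.+2]conj_mouldS subr0 subrK.
have conj0E : conj_mould 0 * G =
    conj_mould 1 + G * conj_mould 0 + derivation wt G.
  by rewrite conj_mouldS /= addrAC subrK subrK.
move: conj_mould conjE conj0E {IHn} => U conjE conj0E.
under eq_big_nat => r /andP[_ rn].
  rewrite mulrnAl -mulrA conjE mulrDr mulrnDl [in X in _ + X]mulrA -exprSr.
  rewrite -subSn // subSS; over.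
rewrite big_split /= -mulrA conj0E !mulrDr mulrA -exprSr.
under [in RHS]eq_bigr do rewrite binS mulrnDr subSS.
rewrite big_split /= [in RHS]big_nat_recr //= bin_small // mulr0n addr0.
rewrite [X in _ = _ + (_ + X)]big_nat_recl //= subn0 bin0 mulr1n.
set a := \sum_(_ <= _ < _) _; set b := \sum_(_ <= _ < _) _.
by rewrite [X in X - _]addrAC addrK addrACA addrC -addrA.
Qed.

Lemma eq_below_mouldM n (M M' N N' : mould T k) :
  (forall w, (size w < n)%N -> M w = M' w) ->
  (forall w, (size w < n)%N -> N w = N' w) ->
  forall w, (size w < n)%N -> (M * N) w = (M' * N') w.
Proof.
move=> MM NN w wn; rewrite !mouldM; apply: eq_big_nat => i /andP[_ iw].
by rewrite MM ?NN // ?size_drop ?size_takel //; lia.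
Qed.

(** [e^{-G} (letter - derivation wt) e^G = F - derivation wt]. *)
Lemma conj_mould_exp (S F : mould T k) :
  (forall n w, (size w < n)%N ->
     S w = (\sum_(0 <= r < n) (r`!%:R)^-1 *: G ^+ r) w) ->
  derivation wt S = letter k * S - S * F ->
  forall n w, (size w < n)%N ->
    (\sum_(0 <= r < n) (r`!%:R)^-1 *: conj_mould r) w = F w.
Proof.
move=> expG eqS n; set E := \sum_(0 <= r < n) _ *: conj_mould r.
have S0 : S [::] = 1.
  by rewrite (expG 1%N) // big_nat1 expr0 mouldZ invr1 mulr1.
apply: (mould_mulIl_below S0) => w wn.
have -> : S * F = letter k * S - derivation wt S by rewrite eqS opprB addrC subrK.
set e := \sum_(0 <= r < n) (r`!%:R)^-1 *: G ^+ r : mould T k.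
have Se v : (size v < n)%N -> S v = e v by exact: expG.
have -> : (S * E) w = (e * E) w by apply: (eq_below_mouldM (n := n)).
have -> : (letter k * S - derivation wt S) w =
    (letter k * e - derivation wt e) w.
  rewrite !mouldB (eq_below_mouldM (n := n) (M' := letter k) _ Se) //.
  by rewrite /derivation Se.
have -> : letter k * e - derivation wt e =
    \sum_(0 <= m < n) \sum_(0 <= r < m.+1)
      ((r`!%:R)^-1 * ((m - r)`!%:R)^-1) *: (G ^+ (m - r) * conj_mould r).
  rewrite mulr_sumr derivation_sum -sumrB; apply: eq_big_nat => m _.
  rewrite derivationZ -scalerAr -scalerBr conj_mould_binomial scaler_sumr.
  apply: eq_big_nat => r /andP[_ rm]; rewrite -scaler_nat scalerA.
  congr (_ *: _); rewrite ltnS in rm; rewrite -(bin_fact rm) !natrM.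
  have := fact_neq0_char0 chark0 r; have := fact_neq0_char0 chark0 (m - r).
  have : 'C(m, r)%:R != 0 :> k by rewrite (pcharf0P k).1 // -lt0n bin_gt0.
  move: (_%:R) (_%:R) (_%:R) => a b c a0 b0 c0; field.
  by rewrite a0 b0 c0.
rewrite -(sum_triangle n (fun r s =>
  ((r`!%:R)^-1 * (s`!%:R)^-1) *: (G ^+ s * conj_mould r))).
rewrite /e /E mulr_sumr !mould_sumE; apply: eq_bigr => r _.
rewrite mulr_suml !mould_sumE; apply: eq_bigr => s _.
rewrite -scalerAl -scalerAr scalerA.
case: ifP => rs; rewrite mouldZ; first by rewrite mouldZ [_^-1 * _]mulrC.
rewrite (@vanishes_belowM _ _ s r) ?mulr0 //; last by rewrite addnC; lia.
  exact/vanishes_belowX/primitive_nil.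
exact: conj_mould_vanishes.
Qed.

End Conjugation.

(** * Iterated brackets and alternal moulds *)

Section LieBracket.
Variables (k : fieldType) (L : lieAlgebraType k).
Implicit Types x y z : L.

Lemma lieDl x y z : lie (x + y) z = lie x z + lie y z.
Proof. by have := lie_linearl 1 x y z; rewrite !scale1r. Qed.

Lemma lieDr x y z : lie z (x + y) = lie z x + lie z y.
Proof. by have := lie_linearr 1 x y z; rewrite !scale1r. Qed.

Lemma lie0l z : lie 0 z = 0.
Proof. by apply: (addIr (lie 0 z)); rewrite -lieDl !add0r. Qed.

Lemma lie0r z : lie z 0 = 0.
Proof. by apply: (addIr (lie z 0)); rewrite -lieDr !add0r. Qed.

Lemma lieZl (a : k) x z : lie (a *: x) z = a *: lie x z.
Proof. by rewrite -[a *: x]addr0 lie_linearl lie0l addr0. Qed.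

Lemma lieZr (a : k) x z : lie z (a *: x) = a *: lie z x.
Proof. by rewrite -[a *: x]addr0 lie_linearr lie0r addr0. Qed.

Lemma lieBr x y z : lie z (x - y) = lie z x - lie z y.
Proof. by rewrite lieDr -scaleN1r lieZr scaleN1r. Qed.

Lemma lieBl x y z : lie (x - y) z = lie x z - lie y z.
Proof. by rewrite lieDl -scaleN1r lieZl scaleN1r. Qed.

Lemma lie_suml (J : Type) (r : seq J) (F : J -> L) z :
  lie (\sum_(j <- r) F j) z = \sum_(j <- r) lie (F j) z.
Proof.
by elim/big_rec2: _ => [|j a b _ <-]; [exact: lie0l | exact: lieDl].
Qed.

Lemma lie_sumr (J : Type) (r : seq J) (F : J -> L) z :
  lie z (\sum_(j <- r) F j) = \sum_(j <- r) lie z (F j).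
Proof.
by elim/big_rec2: _ => [|j a b _ <-]; [exact: lie0r | exact: lieDr].
Qed.

Lemma lieC x y : lie x y = - lie y x.
Proof.
apply/eqP; rewrite -addr_eq0; have := lie_alternating (x + y).
by rewrite lieDl !lieDr !lie_alternating add0r addr0 => ->.
Qed.

Lemma lieA x y z : lie (lie x y) z = lie x (lie y z) - lie y (lie x z).
Proof.
have := lie_jacobi x y z; rewrite [lie z (lie x y)]lieC [lie z x]lieC.
have lieN (u v : L) : lie u (- v) = - lie u v by rewrite -[- v]scaleN1r lieZr scaleN1r.
by rewrite lieN => /eqP; rewrite subr_eq0 => /eqP->.
Qed.

End LieBracket.

Section Words.
Variables (I : Type) (J : seq I).

Fixpoint words (n : nat) : seq (seq I) :=
  if n is n'.+1 then [seq x :: w | x <- J, w <- words n'] else [:: [::]].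

Variable V : nmodType.
Implicit Types (f : seq I -> V).

Lemma sum_words0 f : \sum_(w <- words 0) f w = f [::].
Proof. exact: big_seq1. Qed.

Lemma sum_wordsS f n : \sum_(w <- words n.+1) f w =
  \sum_(x <- J) \sum_(w <- words n) f (x :: w).
Proof. by rewrite /= big_allpairs_dep. Qed.

Lemma eq_sum_words n f (g : seq I -> V) : (forall w, size w = n -> f w = g w) ->
  \sum_(w <- words n) f w = \sum_(w <- words n) g w.
Proof.
elim: n f g => [|n IHn] f g fg; first by rewrite !sum_words0 fg.
rewrite !sum_wordsS; apply: eq_bigr => x _; apply: IHn => w wn.
by rewrite fg //= wn.
Qed.

Lemma sum_words_cat m n f : \sum_(w <- words (m + n)) f w =
  \sum_(u <- words m) \sum_(v <- words n) f (u ++ v).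
Proof.
elim: m f => [|m IHm] f; first by rewrite sum_words0.
by rewrite addSn !sum_wordsS; apply: eq_bigr => x _; rewrite IHm.
Qed.

Lemma sum_words_rev n f :
  \sum_(w <- words n) f (rev w) = \sum_(w <- words n) f w.
Proof.
elim: n f => [|n IHn] f; first by rewrite !sum_words0.
rewrite sum_wordsS -addn1 sum_words_cat.
under [RHS]eq_bigr do rewrite sum_wordsS.
rewrite [RHS]exchange_big; apply: eq_bigr => x _ /=.
rewrite -[RHS]IHn; apply: eq_bigr => w _; rewrite big_seq1.
by rewrite rev_cons -cats1.
Qed.

Definition sum_word_pairs s (g : seq I -> seq I -> V) : V :=
  \sum_(0 <= i < s.+1) \sum_(u <- words i) \sum_(v <- words (s - i)) g u v.

Lemma eq_sum_word_pairs s (g g' : seq I -> seq I -> V) :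
  (forall u v, (size u + size v)%N = s -> g u v = g' u v) ->
  sum_word_pairs s g = sum_word_pairs s g'.
Proof.
move=> gg'; apply: eq_big_nat => i /andP[_ si].
apply: eq_sum_words => u ui; apply: eq_sum_words => v vi.
by apply: gg'; rewrite ui vi subnKC.
Qed.

Lemma sum_word_pairsD s (g g' : seq I -> seq I -> V) :
  sum_word_pairs s (fun u v => g u v + g' u v) =
  sum_word_pairs s g + sum_word_pairs s g'.
Proof.
rewrite /sum_word_pairs -big_split; apply: eq_bigr => i _.
rewrite -big_split; apply: eq_bigr => u _.
by rewrite -big_split.
Qed.

Lemma sum_word_pairs_consl s (g : I -> seq I -> seq I -> V) :
  sum_word_pairs s.+1 (fun u v => if u is x :: u' then g x u' v else 0) =
  \sum_(x <- J) sum_word_pairs s (g x).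
Proof.
rewrite /sum_word_pairs big_nat_recl // sum_words0 big1 // add0r.
rewrite [RHS]exchange_big; apply: eq_bigr => i _ /=.
by rewrite sum_wordsS.
Qed.

Lemma sum_word_pairs_consr s (g : I -> seq I -> seq I -> V) :
  sum_word_pairs s.+1 (fun u v => if v is x :: v' then g x u v' else 0) =
  \sum_(x <- J) sum_word_pairs s (g x).
Proof.
rewrite /sum_word_pairs big_nat_recr //= subnn.
rewrite [X in _ + X]big1 ?addr0; last by move=> u _; rewrite big_seq1.
rewrite [RHS]exchange_big; apply: eq_big_nat => i /andP[_ si] /=.
rewrite [RHS]exchange_big; apply: eq_bigr => u _ /=.
by rewrite subSn // sum_wordsS.
Qed.

End Words.

(** Alternality for the words [x :: u] and [v] moves the first letter [y] of [v]
    in front of [x], at the cost of a sign; [y] then plays the role of [x]. *)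
Lemma primitive_reversal (I : Type) (k : fieldType) (M : mould I k) x u v :
  primitive M ->
  sh (shift x M) u v = (-1) ^+ size v * M (rev v ++ x :: u).
Proof.
move=> /primitiveP[_ altM]; elim: v x u => [|y v IHv] x u.
  by rewrite sh_nilr mul1r.
have : sh M (x :: u) (y :: v) = 0 by exact: altM.
rewrite sh_cons => /eqP; rewrite addr_eq0 => /eqP->.
by rewrite IHv rev_cons cat_rcons exprS mulN1r mulNr.
Qed.

Section Comould.
Variables (k : fieldType) (L : lieAlgebraType k) (I : Type).
Hypothesis chark0 : [pchar k] =i pred0.
Variables (B : I -> L) (J : seq I).
Implicit Types (M N : mould I k) (u v w : seq I) (x y z : L).

Definition ad_word w x : L := foldl (fun x n => lie (B n) x) x w.

Definition nested w : L := if w is n :: w' then ad_word w' (B n) else 0.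

Lemma ad_word_cat u v x : ad_word (u ++ v) x = ad_word v (ad_word u x).
Proof. exact: foldl_cat. Qed.

Lemma ad_wordD w x y : ad_word w (x + y) = ad_word w x + ad_word w y.
Proof. by elim: w x y => //= n w IHw x y; rewrite lieDr IHw. Qed.

Lemma ad_wordZ w (a : k) x : ad_word w (a *: x) = a *: ad_word w x.
Proof. by elim: w x => //= n w IHw x; rewrite lieZr IHw. Qed.

Lemma ad_wordN w x : ad_word w (- x) = - ad_word w x.
Proof. by rewrite -!scaleN1r ad_wordZ. Qed.

Lemma ad_word_sum w (K : Type) (r : seq K) (F : K -> L) :
  ad_word w (\sum_(j <- r) F j) = \sum_(j <- r) ad_word w (F j).
Proof.
elim/big_rec2: _ => [|j a b _ <-]; last by rewrite ad_wordD.
by elim: w => //= n w; rewrite lie0r.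
Qed.

(** Each letter [n] of [w] acts on [[z, y]] either through [z] or through [y],
    since [[[b, z], y] = [b, [z, y]] - [z, [b, y]]]: the letters are shared out
    between two words [u] and [v], of which [w] is a shuffle. *)
Lemma lie_ad_word M s z y :
  \sum_(w <- words J s) M w *: lie (ad_word w z) y =
  sum_word_pairs J s (fun u v => ((-1) ^+ size v * sh M u v) *:
    ad_word u (lie z (ad_word (rev v) y))).
Proof.
elim: s M z => [|s IHs] M z.
  by rewrite sum_words0 /sum_word_pairs big_nat1 !big_seq1 /= mul1r sh_nill.
rewrite sum_wordsS.
pose g n u v := ((-1) ^+ size v * sh (shift n M) u v) *:
  ad_word (n :: u) (lie z (ad_word (rev v) y)).
pose h n u v := ((-1) ^+ size (n :: v) * sh (shift n M) u v) *:
  ad_word u (lie z (ad_word (rev (n :: v)) y)).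
transitivity (\sum_(n <- J) (sum_word_pairs J s (g n) +
                             sum_word_pairs J s (h n))).
  apply: eq_bigr => n _; rewrite -sum_word_pairsD.
  rewrite (IHs (shift n M) (lie (B n) z)).
  apply: eq_sum_word_pairs => u v _.
  rewrite lieA /g /h rev_cons /ad_word foldl_rcons /= -!/(ad_word _ _).
  rewrite exprS mulN1r mulNr scaleNr -scalerBr; congr (_ *: _).
  by rewrite ad_wordD ad_wordN.
rewrite big_split /= -sum_word_pairs_consl -sum_word_pairs_consr.
rewrite -sum_word_pairsD; apply: eq_sum_word_pairs => -[|n u] [|n' v] // _.
- by rewrite add0r /h !sh_nill.
- by rewrite addr0 /g !sh_nilr.
rewrite sh_cons mulrDr scalerDl; congr (_ *: _ + _ *: _).
Qed.

(** The Dynkin-Specht-Wever identity, in the representation of words by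
    products of adjoint maps: for [M] alternal, each of the [n] places of the
    first letter contributes the same sum over words of length [n]. *)
Lemma lie_sum_nested M n y : primitive M ->
  \sum_(w <- words J n) M w *: lie (nested w) y =
  n%:R *: \sum_(w <- words J n) M w *: ad_word w y.
Proof.
move=> pM; case: n => [|n].
  by rewrite !sum_words0 (primitive_nil pM) !scale0r.
rewrite sum_wordsS /=.
under eq_bigr => x _ do rewrite (lie_ad_word (shift x M)).
under eq_bigr => x _.
  rewrite (eq_sum_word_pairs (g' := fun u v =>
    M (rev v ++ x :: u) *: ad_word (rev v ++ x :: u) y) _); last first.
    move=> u v _; rewrite (primitive_reversal x u v pM) mulrA -expr2 sqrr_sign.
    by rewrite mul1r ad_word_cat.
  over.
rewrite /sum_word_pairs exchange_big /=.
transitivity (\sum_(0 <= i < n.+1)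
    \sum_(w <- words J n.+1) M w *: ad_word w y); last first.
  by rewrite big_const_nat subn0 iter_addr_0 scaler_nat.
apply: eq_big_nat => i /andP[_ ni].
have -> : n.+1 = (n - i + i.+1)%N by lia.
rewrite sum_words_cat -(sum_words_rev J (n - i)).
under [RHS]eq_bigr do rewrite sum_wordsS.
rewrite [RHS]exchange_big; apply: eq_bigr => x _ /=.
by rewrite [RHS]exchange_big.
Qed.

Definition comould M n : L :=
  n%:R^-1 *: \sum_(w <- words J n) M w *: nested w.

Lemma comould0 M : comould M 0 = 0.
Proof. by rewrite /comould sum_words0 scaler0 scaler0. Qed.

Lemma lie_comould M n y : primitive M ->
  lie (comould M n) y = \sum_(w <- words J n) M w *: ad_word w y.
Proof.
move=> pM; case: n => [|n].
  by rewrite comould0 lie0l sum_words0 (primitive_nil pM) scale0r.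
rewrite lieZl lie_suml; under eq_bigr do rewrite lieZl.
by rewrite lie_sum_nested // scalerA mulVf ?scale1r // (pcharf0P k).1.
Qed.

(** Contribution to the product of moulds [M * N] of the cuts into pieces of
    lengths [p] and [q], before normalization. *)
Definition comould_pair M N p q : L :=
  \sum_(u <- words J p) \sum_(v <- words J q) (M u * N v) *: nested (u ++ v).

Lemma lie_comould_comould M N p q : primitive M -> primitive N ->
  q%:R *: lie (comould M p) (comould N q) = comould_pair N M q p.
Proof.
move=> pM pN; case: q => [|q].
  rewrite scale0r /comould_pair sum_words0 (primitive_nil pN) big1 // => v _.
  by rewrite mul0r scale0r.
rewrite lie_comould // scaler_sumr /comould_pair exchange_big /=.
apply: eq_bigr => v _; rewrite ad_wordZ ad_word_sum scalerA mulrC -scalerA.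
rewrite [LHS]scalerA mulfV ?scale1r ?(pcharf0P k).1 // scaler_sumr.
apply: eq_sum_words => -[|n u] // _.
by rewrite ad_wordZ scalerA mulrC /= ad_word_cat.
Qed.

(** Both brackets [[M, N]] and [-[N, M]] compute the same element, weighted by
    [q] and by [p]; their sum makes the normalization by the total length
    appear. *)
Lemma lie_comouldE M N p q : primitive M -> primitive N ->
  lie (comould M p) (comould N q) =
  (p + q)%:R^-1 *: (comould_pair N M q p - comould_pair M N p q).
Proof.
move=> pM pN; have [pq0|pq] := eqVneq (p + q)%N 0%N.
  by rewrite pq0 (_ : p = 0%N) ?comould0 ?lie0l ?invr0 ?scale0r //; lia.
rewrite -!lie_comould_comould // [lie (comould N q) _]lieC scalerN opprK.
rewrite -scalerDl -natrD addnC scalerA mulVf ?scale1r // (pcharf0P k).1 //.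
by rewrite addnC.
Qed.

Lemma comouldM M N n :
  \sum_(w <- words J n) (M * N) w *: nested w =
  \sum_(0 <= i < n.+1) comould_pair M N i (n - i).
Proof.
transitivity (\sum_(w <- words J n) \sum_(0 <= i < n.+1)
    (M (take i w) * N (drop i w)) *: nested w).
  by apply: eq_sum_words => w wn; rewrite mouldM wn scaler_suml.
rewrite exchange_big; apply: eq_big_nat => i /andP[_ ni] /=.
rewrite -{1}(subnKC (_ : i <= n)%N) // sum_words_cat.
apply: eq_sum_words => u ui; apply: eq_bigr => v _.
by rewrite take_size_cat // drop_size_cat.
Qed.

Lemma comould_commutator M N n : comould (N * M - M * N) n =
  \sum_(0 <= p < n.+1)
    n%:R^-1 *: (comould_pair N M (n - p) p - comould_pair M N p (n - p)).
Proof.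
rewrite /comould -scaler_sumr; congr (_ *: _); rewrite sumrB.
under eq_bigr do rewrite mouldB scalerBl.
rewrite sumrB !comouldM; congr (_ - _).
rewrite big_nat_rev; apply: eq_big_nat => i /andP[_ ni].
by rewrite add0n subSS subKn.
Qed.

Lemma comouldB M N n : comould (M - N) n = comould M n - comould N n.
Proof.
rewrite /comould -scalerBr -sumrB; congr (_ *: _).
by apply: eq_bigr => w _; rewrite mouldB scalerBl.
Qed.

Lemma comouldZ (c : k) M n : comould (c *: M) n = c *: comould M n.
Proof.
rewrite /comould scalerA mulrC -scalerA scaler_sumr; congr (_ *: _).
by apply: eq_bigr => w _; rewrite mouldZ scalerA.
Qed.

Section Eigenvectors.
Variables (X0 : L) (lambda : I -> k).
Hypothesis eigB : forall n, lie X0 (B n) = lambda n *: B n.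

(** The bracket with [X0] is a derivation, so that eigenvalues add up. *)
Lemma lie_ad_word_eigen w z c : lie X0 z = c *: z ->
  lie X0 (ad_word w z) = (c + sigma (map lambda w)) *: ad_word w z.
Proof.
elim: w z c => [|n w IHw] z c zc /=.
  by rewrite /sigma big_nil addr0.
rewrite (IHw _ (lambda n + c)).
  by rewrite /sigma /= big_cons [lambda n + c]addrC addrA.
have /eqP := lieA X0 (B n) z; rewrite eq_sym subr_eq => /eqP->.
by rewrite eigB zc lieZl lieZr scalerDl.
Qed.

Lemma lie_nested_eigen w :
  lie X0 (nested w) = sigma (map lambda w) *: nested w.
Proof.
case: w => [|n w]; first by rewrite lie0r scaler0.
by rewrite /nested (lie_ad_word_eigen _ (eigB n)) /sigma /= big_cons.
Qed.

Lemma lie_comould_eigen M n : lie X0 (comould M n) =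
  comould (derivation (fun w => sigma (map lambda w)) M) n.
Proof.
rewrite lieZr lie_sumr; congr (_ *: _); apply: eq_bigr => w _.
by rewrite lieZr lie_nested_eigen scalerA mulrC.
Qed.

End Eigenvectors.

End Comould.

(** * Summable families *)

Section Filtration.
Variables (k : fieldType) (L : filteredLieType k).
Implicit Types x y z : L.

Lemma filZ m (a : k) x : fil m x -> fil m (a *: x).
Proof. by move=> mx; rewrite -[a *: x]addr0; apply/fil_linear/fil_zero. Qed.

Lemma filD m x y : fil m x -> fil m y -> fil m (x + y).
Proof. by move=> mx my; rewrite -[x]scale1r; exact: fil_linear. Qed.

Lemma filN m x : fil m x -> fil m (- x).
Proof. by rewrite -scaleN1r; exact: filZ. Qed.

Lemma filB m x y : fil m x -> fil m y -> fil m (x - y).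
Proof. by move=> mx my; apply/filD/filN. Qed.

Lemma fil_sum m (J : Type) (r : seq J) (P : pred J) (F : J -> L) :
  (forall j, P j -> fil m (F j)) -> fil m (\sum_(j <- r | P j) F j).
Proof.
move=> mF; elim/big_rec: _ => [|j x Pj]; first exact: fil_zero.
exact/filD/mF.
Qed.

Lemma fil_trans m x y z : fil m (x - y) -> fil m (y - z) -> fil m (x - z).
Proof. by move=> xy yz; rewrite -[x](subrK y) -addrA; exact: filD. Qed.

Lemma fil_sym m x y : fil m (x - y) -> fil m (y - x).
Proof. by rewrite -[y - x]opprB; exact: filN. Qed.

Lemma fil_all0 x : (forall m, fil m x) -> x = 0.
Proof.
by move=> mx; have : (\bigcap_m fil m)%classic x by []; rewrite fil_separated.
Qed.

Lemma fil0 x : fil 0 x. Proof. by rewrite fil_full. Qed.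

Lemma fil_lie_l m x y : fil m x -> fil m (lie x y).
Proof. by move=> mx; rewrite -[m]addn0; exact/fil_lie/fil0. Qed.

Lemma fil_lie_r m x y : fil m y -> fil m (lie x y).
Proof. by move=> my; rewrite -[m]add0n; exact/fil_lie/my/fil0. Qed.

Lemma fil_lie_congr m x x' y y' :
  fil m (x - x') -> fil m (y - y') -> fil m (lie x y - lie x' y').
Proof.
move=> xx' yy'; apply: (@fil_trans _ _ (lie x' y)).
  by rewrite -lieBl; exact: fil_lie_l.
by rewrite -lieBr; exact: fil_lie_r.
Qed.

Lemma dist_small (e : Rdefinitions.R) : 0 < e ->
  exists m, forall x y, fil m (y - x) -> dist x y < e.
Proof.
move=> e0; exists (Num.bound e^-1) => x y /ord_geP.
rewrite /dist; case: (ord _) => [n|] //= mn.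
rewrite exprVn invf_plt ?posrE ?exprn_gt0 //.
exact: upper_nthrootP.
Qed.

Lemma fil_dist m x y : dist x y < 2^-1 ^+ m -> fil m (y - x).
Proof.
move=> dm; apply/ord_geP; move: dm; rewrite /dist; case: (ord _) => //= n.
by rewrite ltr_iXn2l ?invr_gt0 ?invf_lt1 ?ltr1n // => /ltnW.
Qed.

End Filtration.

Section Approximation.
Variables (k : fieldType) (L : completeFilteredLieType k).

Definition carrier_upto (T : eqType) m (Y : T -> L) (D : seq T) : Prop :=
  uniq D /\ forall i, i \notin D -> fil m (Y i).

Lemma fil_sum_carriers (T : eqType) m (Y : T -> L) D D' :
  uniq D -> uniq D' ->
  (forall i, i \in D -> i \notin D' -> fil m (Y i)) ->
  (forall i, i \in D' -> i \notin D -> fil m (Y i)) ->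
  fil m (\sum_(i <- D) Y i - \sum_(i <- D') Y i).
Proof.
move=> uD uD' DD' D'D.
have splitE (E E' : seq T) : \sum_(i <- E) Y i =
    \sum_(i <- [seq i <- E | i \in E']) Y i + \sum_(i <- E | i \notin E') Y i.
  by rewrite (bigID (mem E')) big_filter.
rewrite (splitE D D') (splitE D' D).
have -> : \sum_(i <- [seq i <- D' | i \in D]) Y i =
    \sum_(i <- [seq i <- D | i \in D']) Y i.
  apply: perm_big; apply: uniq_perm; rewrite ?filter_uniq // => i.
  by rewrite !mem_filter andbC.
rewrite opprD addrACA subrr add0r.
by apply: filB; rewrite big_seq_cond; apply: fil_sum => i /andP[]; [exact: DD' | exact: D'D].
Qed.

Lemma carriers_fil (T : eqType) m (Y : T -> L) D D' :
  carrier_upto m Y D -> carrier_upto m Y D' ->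
  fil m (\sum_(i <- D) Y i - \sum_(i <- D') Y i).
Proof.
move=> [uD YD] [uD' YD'].
by apply: fil_sum_carriers => // i _; [exact: YD' | exact: YD].
Qed.

Lemma carrier_upto_le (T : eqType) m n (Y : T -> L) D :
  (m <= n)%N -> carrier_upto n Y D -> carrier_upto m Y D.
Proof. by move=> mn [uD YD]; split=> // i /YD; exact: fil_le. Qed.

(** Up to order [m], the partial sums over all large enough finite sets agree
    with the sum over a single set carrying [Y], which replaces exhaustions. *)
Lemma has_sumI (T : eqType) (Y : T -> L) (s : L) :
  (forall m, exists2 D, carrier_upto m Y D & fil m (s - \sum_(i <- D) Y i)) ->
  has_sum Y s.
Proof.
move=> carried; split=> [m|E [finE incrE unionE] e e0].
  have [D [_ YD] _] := carried m.
  apply: (@sub_finite_set _ _ [set` D]%classic); last exact: finite_seq.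
  by move=> i /= Yi; apply/negPn/negP => /YD.
have [m dist_e] := dist_small L e0; have [D [uD YD] sD] := carried m.
have mono p n i : (p <= n)%N -> E p i -> E n i.
  by move/subnK <-; elim: (n - p)%N => // d IHd /IHd; exact: incrE.
(* Indices with a zero term never enter the exhaustion, which only covers the
   support of [Y]. *)
have [p Dp] : exists p, forall i, i \in D -> Y i <> 0 -> E p i.
  elim: (D) => [|i D' [p Dp]]; first by exists 0%N.
  have [Yi0|Yi0] := pselect (Y i = 0).
    by exists p => j; rewrite inE => /orP[/eqP->|]; [|exact: Dp].
  have [q _ Eqi] : (\bigcup_n E n)%classic i by rewrite unionE.
  exists (maxn p q) => j; rewrite inE => /orP[/eqP-> _|jD' Yj].
    exact: mono (leq_maxr _ _) Eqi.
  exact: mono (leq_maxl _ _) (Dp j jD' Yj).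
exists p => n pn; apply: dist_e.
(* The same list, read over the classical equality of [T] that indexes the
   partial sums. *)
pose toC (i : T) : {classic T} := i.
have toC_inj : injective toC by [].
have [r0 Er0] := (finite_seqP (T := {classic T}) (E n)).1 (finE n).
pose r := undup r0; have ur : uniq r := undup_uniq r0.
have -> : \sum_(i \in (E n : set {classic T})) (Y i : L) = \sum_(i <- r) Y i.
  rewrite (@fsbig_seq _ _ _ _ r (fun i : {classic T} => Y i : L)) //.
  by congr (\sum_(i \in _) _)%R; rewrite Er0; apply/seteqP; split=> i /=; rewrite mem_undup.
have memD i : (toC i \in [seq toC j | j <- D]) = (i \in D) := mem_map toC_inj D i.
apply: (fil_trans sD).
rewrite -[X in X - _](big_map toC xpredT (fun i : {classic T} => Y i : L)).
apply: (fil_sum_carriers (T := {classic T})) => //.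
- by rewrite map_inj_uniq.
- move=> i; rewrite (memD i) => iD /negP ir.
  have [->|Yi0] := pselect (Y i = 0); first exact: fil_zero.
  case: ir; rewrite mem_undup; have := mono p n i pn (Dp i iD Yi0).
  by rewrite Er0.
by move=> i _; rewrite (memD i) => /YD.
Qed.

(** By completeness, a family that is carried by finite sets has a sum, which
    is approximated at each order by the sum over any finite set carrying it. *)
Lemma carried_has_sum (T : eqType) (Y : T -> L) :
  (forall m, exists D, carrier_upto m Y D) ->
  exists2 s, has_sum Y s &
    forall m D, carrier_upto m Y D -> fil m (s - \sum_(i <- D) Y i).
Proof.
move=> /choice[D carD]; pose u m := \sum_(i <- D m) Y i.
have fil_u m n n' : (m <= n)%N -> (m <= n')%N -> fil m (u n - u n').
  by move=> mn mn'; apply: carriers_fil; exact: carrier_upto_le (carD _).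
have [s u_s] : exists s : L, converges_to u s.
  apply: fil_complete => e e0; have [m dist_e] := dist_small L e0.
  by exists m => a b ma mb; apply: dist_e; exact: fil_u.
have su m D' : carrier_upto m Y D' -> fil m (s - \sum_(i <- D') Y i).
  move=> carD'; have [//|p dist_p] := u_s (2^-1 ^+ m) _.
    by rewrite exprn_gt0 // invr_gt0.
  apply: (@fil_trans _ _ _ _ (u (maxn p m))).
    exact/fil_dist/dist_p/leq_maxl.
  apply: carriers_fil carD'.
  exact: carrier_upto_le (leq_maxr _ _) (carD _).
by exists s => //; apply: has_sumI => m; exists (D m); [|exact: su].
Qed.

Lemma formally_summable_carried (I : Type) (B : I -> L) m :
  formally_summable B -> exists J, carrier_upto (T := {classic I}) m B J.
Proof.
move=> /(_ m) /(finite_seqP (T := {classic I}))[r Br].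
exists (undup r); split=> [|i]; first exact: undup_uniq.
rewrite mem_undup => /negP ir; apply: contrapT => nBi; apply: ir.
by have : [set` r]%classic i by rewrite -Br.
Qed.

End Approximation.

(** * Lie comoulds in a complete filtered Lie algebra *)

Section ShortWords.
Variables (I : eqType) (J : seq I).

Fixpoint short_words (m : nat) : seq (seq I) :=
  if m is m'.+1 then [::] :: [seq x :: w | x <- J, w <- short_words m']
  else [::].

Lemma mem_short_words m w :
  (w \in short_words m) = (size w < m)%N && all (mem J) w.
Proof.
elim: m w => [|m IHm] w; first by rewrite ltn0.
rewrite inE; case: w => [|x w] //=; rewrite ltnS.
apply/allpairsP/idP => [[[y v] /= [yJ vm [-> ->]]]|/and3P[wm xJ wJ]].
  by rewrite IHm in vm; case/andP: vm => -> ->; rewrite yJ.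
by exists (x, w); rewrite /= IHm wm.
Qed.

Lemma short_words_uniq m : uniq J -> uniq (short_words m).
Proof.
move=> uJ; elim: m => //= m IHm; apply/andP; split.
  by apply/allpairsP => -[[x w] []].
by apply: allpairs_uniq => // -[x w] [y v] _ _ [-> ->].
Qed.

Lemma sum_short_words (V : nmodType) m (f : seq I -> V) :
  \sum_(w <- short_words m) f w =
  \sum_(0 <= n < m) \sum_(w <- words J n) f w.
Proof.
elim: m f => [|m IHm] f; first by rewrite big_nil big_geq.
rewrite big_cons big_allpairs_dep big_nat_recl // sum_words0; congr (_ + _).
under eq_bigr do rewrite IHm.
by rewrite exchange_big; apply: eq_bigr => n _; rewrite sum_wordsS.
Qed.

End ShortWords.

Section FilteredComould.
Variables (k : fieldType) (L : completeFilteredLieType k) (I : Type).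
Hypothesis chark0 : [pchar k] =i pred0.
Variable B : I -> L.
Hypothesis B1 : forall n, fil 1 (B n).
Implicit Types (M N : mould I k).

Lemma fil_ad_word p z w : fil p z -> fil (size w + p) (ad_word B w z).
Proof.
elim: w p z => [|n w IHw] p z pz //=.
by rewrite addSnnS; apply: IHw; exact: fil_lie (B1 n) pz.
Qed.

Lemma fil_nested w : fil (size w) (nested B w).
Proof.
by case: w => [|n w]; [exact: fil_zero | rewrite /= -addn1; exact: fil_ad_word].
Qed.

Lemma fil_ad_word_r m z w : fil m z -> fil m (ad_word B w z).
Proof. by elim: w z => //= n w IHw z mz; exact/IHw/fil_lie_r. Qed.

Lemma fil_ad_word_letter m z w :
  has (fun n => `[< fil m (B n) >]) w -> fil m (ad_word B w z).
Proof.
elim: w z => //= n w IHw z /orP[/asboolP mn|/IHw//].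
exact/fil_ad_word_r/fil_lie_l.
Qed.

Lemma fil_nested_letter m w :
  has (fun n => `[< fil m (B n) >]) w -> fil m (nested B w).
Proof.
case: w => [|n w] //= /orP[/asboolP|]; first exact: fil_ad_word_r.
exact: fil_ad_word_letter.
Qed.

Lemma fil_sum_words (J : seq I) m n (f : seq I -> L) :
  (forall w, size w = n -> fil m (f w)) ->
  fil m (\sum_(w <- words J n) f w).
Proof.
elim: n f => [|n IHn] f mf; first by rewrite sum_words0; exact: mf.
rewrite sum_wordsS; apply: fil_sum => x _; apply: IHn => w wn.
by apply: mf; rewrite /= wn.
Qed.

Lemma fil_comould (J : seq I) M n : fil n (comould B J M n).
Proof.
by apply/filZ/fil_sum_words => w <-; apply/filZ/fil_nested.
Qed.

Definition comould_upto (J : seq I) (n : nat) M : L :=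
  \sum_(0 <= i < n) comould B J M i.

Lemma comould_uptoB J n M N :
  comould_upto J n (M - N) = comould_upto J n M - comould_upto J n N.
Proof. by rewrite -sumrB; apply: eq_bigr => i _; rewrite comouldB. Qed.

Lemma comould_uptoZ J n (c : k) M :
  comould_upto J n (c *: M) = c *: comould_upto J n M.
Proof. by rewrite scaler_sumr; apply: eq_bigr => i _; rewrite comouldZ. Qed.

Lemma comould_upto_sum J n (r : seq nat) (M : nat -> mould I k) :
  comould_upto J n (\sum_(i <- r) M i) = \sum_(i <- r) comould_upto J n (M i).
Proof.
elim: r => [|i r IHr].
  by rewrite !big_nil -[0 in LHS](subrr (0 : mould I k)) comould_uptoB subrr.
rewrite !big_cons -IHr; set N := \sum_(_ <- _) _.
have -> : M i + N = M i - (-1) *: N by rewrite scaleN1r opprK.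
by rewrite comould_uptoB comould_uptoZ scaleN1r opprK.
Qed.

Lemma eq_comould_upto J n M N : (forall w, (size w < n)%N -> M w = N w) ->
  comould_upto J n M = comould_upto J n N.
Proof.
move=> MN; apply: eq_big_nat => i /andP[_ ilt]; congr (_ *: _).
by apply: eq_sum_words => w wi; rewrite MN ?wi.
Qed.

(** Brackets of the parts of lengths [p] and [q] form the part of length
    [p + q] of the commutator by [lie_comouldE]; the truncation only loses
    lengths at least [n]. *)
Lemma lie_comould_upto J n M N : primitive M -> primitive N ->
  fil n (lie (comould_upto J n M) (comould_upto J n N) -
         comould_upto J n (N * M - M * N)).
Proof.
move=> pM pN.
pose g p q := lie (comould B J M p) (comould B J N q).
have -> : lie (comould_upto J n M) (comould_upto J n N) =
    \sum_(0 <= p < n) \sum_(0 <= q < n) g p q.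
  by rewrite lie_suml; apply: eq_bigr => p _; rewrite lie_sumr.
have -> : comould_upto J n (N * M - M * N) =
    \sum_(0 <= p < n) \sum_(0 <= q < n) (if (p + q < n)%N then g p q else 0).
  rewrite sum_triangle; apply: eq_bigr => m _; rewrite comould_commutator.
  apply: eq_big_nat => p /andP[_ pm].
  by rewrite /g lie_comouldE // subnKC.
rewrite -sumrB; apply: fil_sum => p _; rewrite -sumrB; apply: fil_sum => q _.
case: ltnP => [_|npq]; first by rewrite subrr; exact: fil_zero.
by rewrite subr0; apply: (fil_le npq); apply: fil_lie; exact: fil_comould.
Qed.

Lemma comould_upto_letter J n :
  comould_upto J n.+2 (letter k) = \sum_(x <- J) B x.
Proof.
rewrite /comould_upto big_nat_recl // big_nat_recl // comould0 add0r.
rewrite big1 ?addr0 => [|i _]; last first.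
  rewrite /comould (eq_sum_words (g := fun=> 0) _) ?big1 ?scaler0 // => w wi.
  by rewrite /letter wi scale0r.
rewrite /comould invr1 scale1r sum_wordsS; apply: eq_bigr => x _.
by rewrite sum_words0 /letter scale1r.
Qed.

Variable lambda : I -> k.

Lemma comould_termE (M : mould k k) (w : I * seq I) : comould_term lambda B M w =
  (size (w.1 :: w.2))%:R^-1 *:
    (pullback lambda M (w.1 :: w.2) *: nested B (w.1 :: w.2)).
Proof. by rewrite scalerA. Qed.

End FilteredComould.

Section CarriedComould.
Variables (k : fieldType) (L : completeFilteredLieType k) (I : eqType).
Variable B : I -> L.
Hypothesis B1 : forall n, fil 1 (B n).
Variables (lambda : I -> k) (M : mould k k) (m : nat) (J : seq I).
Hypothesis carJ : carrier_upto m B J.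

Definition word_carrier : seq (I * seq I) :=
  [seq (x, w) | x <- J, w <- short_words J m].

(** A word outside the carrier is longer than [m], or has a letter whose [B] is
    negligible at order [m]. *)
Lemma carrier_comould_term :
  carrier_upto m (comould_term lambda B M) word_carrier.
Proof.
have [uJ BJ] := carJ; split=> [|[x w] xw].
  by apply: allpairs_uniq; rewrite ?short_words_uniq // => -[? ?] [? ?] _ _ [-> ->].
rewrite comould_termE; apply/filZ/filZ => /=.
have [wm|mw] := ltnP (size w) m; last first.
  by apply: (fil_le (leqW mw)); exact: (fil_nested B1 (x :: w)).
apply: (@fil_nested_letter _ _ _ _ _ (x :: w)); apply: contraR xw => /hasPn noJ.
have inJ y : y \in x :: w -> y \in J.
  by move=> /noJ/asboolP yB; apply: contrapT => /negP/BJ.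
apply/allpairsP; exists (x, w); split=> //=; first exact/inJ/mem_head.
by rewrite mem_short_words wm; apply/allP => y yw; apply: inJ; rewrite inE yw orbT.
Qed.

Lemma sum_comould_term : \sum_(w <- word_carrier) comould_term lambda B M w =
  comould_upto B J m.+1 (pullback lambda M).
Proof.
rewrite big_allpairs_dep /=.
under eq_bigr do rewrite sum_short_words.
rewrite exchange_big /comould_upto big_nat_recl // comould0 add0r.
apply: eq_bigr => n _; rewrite /comould sum_wordsS scaler_sumr.
apply: eq_bigr => x _; rewrite scaler_sumr; apply: eq_sum_words => w wn.
by rewrite comould_termE /= wn.
Qed.

End CarriedComould.

(** * Normalization *)

Section Normalization.
Variables (k : fieldType) (L : completeFilteredLieType k) (I : eqType).
Hypothesis chark0 : [pchar k] =i pred0.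
Variables (X0 : L) (B : I -> L) (lambda : I -> k).
Hypothesis B1 : forall n, fil 1 (B n).
Hypothesis eigB : forall n, lie X0 (B n) = lambda n *: B n.

Let wt (w : seq I) : k := sigma (map lambda w).

Lemma lie_comould_upto_eigen J n M :
  lie X0 (comould_upto B J n M) = comould_upto B J n (derivation wt M).
Proof.
rewrite lie_sumr; apply: eq_bigr => i _; exact: lie_comould_eigen.
Qed.

Lemma wtD u v : wt (u ++ v) = wt u + wt v.
Proof. by rewrite /wt map_cat sigmaD. Qed.

(** The bracket with [Y] acts on alternal comoulds as the commutator with [G],
    and sends [X0] to minus the comould of [derivation wt G]: this is the
    recursion of [conj_mould]. *)
Lemma iter_ad_approx (m : nat) (J : seq I) (G : mould I k) (Y sumB : L) r :
  primitive G -> fil m (Y - comould_upto B J m.+1 G) ->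
  fil m (sumB - comould_upto B J m.+1 (letter k)) ->
  fil m (iter r (ad Y) (X0 + sumB) -
    ((if r == 0%N then X0 else 0) +
     comould_upto B J m.+1 (conj_mould wt G r))).
Proof.
move=> pG YG sB; elim: r => [|r IHr].
  by rewrite /= opprD addrACA subrr add0r.
rewrite iterS add0r /ad.
apply: fil_trans (fil_lie_congr YG IHr) _.
rewrite conj_mouldS comould_uptoB lieDr opprB addrACA.
apply: filD; last first.
  apply: (fil_le (leqnSn m)); apply: (lie_comould_upto chark0 B1) => //.
  exact/primitive_conj_mould/pG/wtD.
case: eqP => _; last first.
  rewrite lie0r add0r -(subrr (0 : mould I k)) comould_uptoB subrr.
  exact: fil_zero.
rewrite [lie _ X0]lieC lie_comould_upto_eigen addNr; exact: fil_zero.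
Qed.

Lemma normalization_upto (m : nat) (J : seq I) (S F G : mould I k)
    (Y sumB Z : L) :
  primitive G ->
  (forall n w, (size w < n)%N ->
     S w = (\sum_(0 <= r < n) (r`!%:R)^-1 *: G ^+ r) w) ->
  derivation wt S = letter k * S - S * F ->
  fil m (Y - comould_upto B J m.+1 G) ->
  fil m (sumB - comould_upto B J m.+1 (letter k)) ->
  fil m (Z - comould_upto B J m.+1 F) ->
  fil m (X0 + Z -
    \sum_(0 <= r < m.+1) (r`!%:R)^-1 *: iter r (ad Y) (X0 + sumB)).
Proof.
move=> pG expG eqS YG sB ZF.
have FE : comould_upto B J m.+1 F = comould_upto B J m.+1
    (\sum_(0 <= r < m.+1) (r`!%:R)^-1 *: conj_mould wt G r).
  apply/esym/eq_comould_upto.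
  exact: (conj_mould_exp chark0 wtD pG expG eqS).
apply: (@fil_trans _ _ _ _ (\sum_(0 <= r < m.+1) (r`!%:R)^-1 *:
  ((if r == 0%N then X0 else 0) +
   comould_upto B J m.+1 (conj_mould wt G r)))); last first.
  rewrite -sumrB; apply: fil_sum => r _; rewrite -scalerBr.
  exact/filZ/fil_sym/iter_ad_approx.
under eq_bigr do rewrite scalerDr.
rewrite big_split /= [X in _ - (X + _)]big_nat_recl // invr1 scale1r.
rewrite [X in _ - (_ + X + _)]big1 => [|r _]; last by rewrite scaler0.
rewrite addr0 opprD addrACA subrr add0r.
under eq_bigr do rewrite -comould_uptoZ.
by rewrite -comould_upto_sum -FE.
Qed.

End Normalization.

Theorem theorem1 (k : fieldType) (chark0 : [pchar k] =i pred0)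
    (A : seq k -> k) (altA : alternal A) (resA : resonant A) :
  exists S F N G : seq k -> k,
    normalizing_moulds A S F N G /\
    forall (L : completeFilteredLieType k) (X0 : L)
        (I : Type) (B : I -> L) (lambda : I -> k),
      formally_summable B ->
      (forall n : I, ord_ge (ord (B n)) 1) ->
      (forall n : I, ad X0 (B n) = lambda n *: B n) ->
      exists sumB Z Y : L,
        [/\ has_sum B sumB,
            has_sum (comould_term lambda B F) Z
          & has_sum (comould_term lambda B G) Y] /\
        [/\ fil 1 Z, fil 1 Y, lie X0 Z = 0
          & exp_ad Y (X0 + sumB) (X0 + Z)].
Proof.
have [S [F [N [G nSFNG]]]] := normalizing_moulds_exist A.
exists S, F, N, G; split=> // L X0 I B lambda sumB_B ordB eigB.
have symS := symmetral_S chark0 altA nSFNG.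
have GE : G = log_mould S.
  apply/funext => w; rewrite (mould_log nSFNG) log_mouldE //.
  by apply: eq_bigr => j _; rewrite star_powE //; exact: symS.1.
have pG : primitive G by rewrite GE; exact: primitive_log_mould.
pose T : eqType := {classic I}; pose W : eqType := (T * seq T)%type.
have B1 n : fil 1 (B n) by apply/ord_geP.
have carB m := formally_summable_carried m sumB_B.
have carM (M : mould k k) m :
    exists D, carrier_upto (T := W) m (comould_term lambda B M) D.
  have [J carJ] := carB m; exists (word_carrier (I := T) m J).
  exact: carrier_comould_term.
have [sumB has_sumB approxB] := carried_has_sum (T := T) carB.
have [Z has_Z approxZ] := carried_has_sum (carM F).
have [Y has_Y approxY] := carried_has_sum (carM G).
(* Restrict to letters in [J] and read moulds over [k] along [lambda]: the sums
   become finite comoulds over the alphabet [I]. *)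
pose approximated (M : mould k k) (s : L) := forall m D,
  carrier_upto (T := W) m (comould_term lambda B M) D ->
  fil m (s - \sum_(i <- D) comould_term lambda B M i).
have approx M s m J : approximated M s -> carrier_upto (T := T) m B J ->
    fil m (s - comould_upto B J m.+1 (pullback lambda M)).
  move=> approx_s carJ.
  rewrite -(sum_comould_term (I := T)); apply: approx_s.
  exact: carrier_comould_term.
have fil1 M s : approximated M s -> fil 1 s.
  move=> approx_s.
  have [J carJ] := carB 1%N; have approx_s1 := approx _ _ _ _ approx_s carJ.
  rewrite -[s](subrK (comould_upto B J 2 (pullback lambda M))); apply: filD => //.
  rewrite /comould_upto big_nat_recl // comould0 add0r big_nat1.
  exact: fil_comould.
have derF : derivation (fun w : seq T => sigma (map lambda w)) (pullback lambda F) = 0.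
  apply/funext => w.
  exact: (congr1 (fun M : mould k k => M (map lambda w)) (resonant_F nSFNG)).
exists sumB, Z, Y; split=> //; split.
- exact: fil1 F Z approxZ.
- exact: fil1 G Y approxY.
- apply: fil_all0 => m; have [J carJ] := carB m.
  have := fil_lie_r X0 (approx _ _ _ _ approxZ carJ).
  rewrite lieBr (lie_comould_upto_eigen (I := T) eigB) derF.
  rewrite (_ : comould_upto _ _ _ 0 = 0) ?subr0 //.
  by rewrite -[X in comould_upto _ _ _ X](subrr (0 : mould T k)) comould_uptoB subrr.
apply: (has_sumI (T := nat)) => m; exists (iota 0 m.+1).
  split=> [|r]; first exact: iota_uniq.
  rewrite mem_iota /= add0n -leqNgt => mr; apply: filZ; apply: (fil_le (ltnW mr)).
  elim: r {mr} => [|r IHr]; first exact: fil0.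
  by rewrite iterS -add1n; apply: fil_lie IHr; exact: fil1 approxY.
have [J carJ] := carB m.
have := @normalization_upto _ L T chark0 X0 B lambda B1 eigB m J (pullback lambda S)
  (pullback lambda F) (pullback lambda G) Y sumB Z.
rewrite /index_iota subn0; apply.
- exact: primitive_pullback.
- move=> n w wn; rewrite /pullback.
  rewrite (exp_log_mould chark0 symS (n := n)) ?size_map // -GE !mould_sumE.
  apply: eq_bigr => r _; rewrite !mouldZ -pullbackX //.
- rewrite -(pullback_letter _ lambda) -!pullbackM; apply/funext => w.
  exact: (congr1 (fun M : mould k k => M (map lambda w)) (derivation_sigma_S nSFNG)).
- exact: approx approxY carJ.
- (* The one-letter words are only among the short ones when [m > 0]. *)
  case: m carJ => [|m] carJ; first exact: fil0.
  by rewrite comould_upto_letter; exact: approxB.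
exact: approx approxZ carJ.
Qed.
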